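(* Let $n\geq 3$ and $m\geq 1$ be integers, and let $\mathcal{T}(n,m)$ be the class of trees with $n$ vertices and matching number $m$. A tree $T$ has the Faber–Krahn property in the class $\mathcal{T}(n,m)$ (i.e. $T\in\mathcal{T}(n,m)$ and $\lambda_1(T)\le\lambda_1(T')$ for all $T'\in\mathcal{T}(n,m)$) if and only if $T\in\mathcal{T}(n,m)$ and one of the following holds. (1) $m=1$, and $T$ is isomorphic to the star $K_{1,n-1}$. (2) $m\ge 2$, and (a) if $n\ge 2m+1$, then $T$ is isomorphic to $T(2m-3,\,2,\,n+1-2m)$; (b) if $n=2m$, then $T$ is isomorphic to $T(2m-4,\,2,\,2)$.
   Context: All graphs are finite, simple and undirected. For a tree $T=(V,E)$ with at least $3$ vertices, the boundary $B$ is the set of leaves (vertices of degree one) and $\Omega=V\setminus B$ is the interior (nonempty). The Dirichlet eigenvalue problem on $T$ is $-\Delta f(x)=\lambda f(x)$ for $x\in\Omega$, $f(x)=0$ for $x\in B$, where $\Delta f(x)=\sum_{y\sim x}(f(y)-f(x))$. Its smallest eigenvalue is $\lambda_1(T)=\min_{0\ne f\in\mathbb{R}^\Omega} R_T(f)$, where $R_T(f)=\frac{\sum_{xy\in E}(\widehat f(x)-\widehat f(y))^2}{\sum_{x\in\Omega}f(x)^2}$ and $\widehat f$ is the extension of $f$ to $V$ by $0$ on $B$ (each edge is counted once). The matching number of a graph is the maximum number of pairwise disjoint edges in it. A tree $T$ has the Faber–Krahn property in a class $\mathcal{C}$ if $T\in\mathcal{C}$ and $T$ has minimal first Dirichlet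 eigenvalue among all trees in $\mathcal{C}$. For integers $p\ge 0$ and $b\ge q\ge 2$, the tree $T(p,q,b)$ is obtained from a path $u_1\sim u_2\sim\cdots\sim u_{p+q}$ with $p+q$ vertices by attaching one new pendant vertex to each of $u_1,u_{p+2},u_{p+3},\ldots,u_{p+q-1}$ (for $q=2$: only to $u_1$), and attaching $b+1-q$ new pendant vertices to $u_{p+q}$. It has $p+q+b$ vertices, of which $b$ are leaves. *)

(* Defs.v *)
From HB Require Import structures.
From mathcomp Require Import all_boot all_order all_algebra.
From mathcomp Require Import all_classical all_reals.

Set Implicit Arguments.
Unset Strict Implicit.
Unset Printing Implicit Defensive.

Import Order.TTheory GRing.Theory Num.Theory.

Local Open Scope ring_scope.

(* Finite simple undirected graphs. *)
Record sgraph := SGraph {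
  vertex :> finType;
  adj : rel vertex;
  adj_sym : symmetric adj;
  adj_irrefl : irreflexive adj
}.

Definition isomorphic (G H : sgraph) : Prop :=
  exists2 f : G -> H, bijective f & forall x y, adj (f x) (f y) = adj x y.

Section Graph.
Variable G : sgraph.

Definition degree (x : G) : nat := #|[set y | adj x y]|.

Definition connected_graph : Prop := forall x y : G, connect (@adj G) x y.

(* [ucycle] also accepts the degenerate closed walk [:: x; y] along an edge,
   hence the bound on the length. *)
Definition acyclic_graph : Prop :=
  forall c : seq G, (2 < size c)%N -> ~ ucycle (@adj G) c.

Definition is_tree : Prop :=
  [/\ (0 < #|G|)%N, connected_graph & acyclic_graph].

Definition edge_set : {set {set G}} :=
  [set [set p.1; p.2] | p in [set p : G * G | adj p.1 p.2]].

Definition is_matching (M : {set {set G}}) : bool :=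
  (M \subset edge_set) && finset.trivIset M.

Definition matching_number : nat :=
  \max_(M : {set {set G}} | is_matching M) #|M|.

Definition leaves : {set G} := [set x | degree x == 1%N].
Definition inner : {set G} := ~: leaves.

Section Dirichlet.
Variable R : realType.

Definition laplacian (f : {ffun G -> R}) (x : G) : R :=
  \sum_(y | adj x y) (f y - f x).

Definition dirichlet_eigenvalue (l : R) : Prop :=
  exists f : {ffun G -> R},
    [/\ f != 0,
        forall x, x \in inner -> - laplacian f x = l * f x
      & forall x, x \in leaves -> f x = 0].

(* The infimum is a minimum: for a nonempty interior the set of Dirichlet
   eigenvalues is finite and nonempty. *)
Definition lambda1 : R := inf [set l | dirichlet_eigenvalue l]%classic.

End Dirichlet.
End Graph.

Definition faber_krahn (R : realType) (C : sgraph -> Prop) (T : sgraph) : Prop :=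
  C T /\ forall T' : sgraph, C T' -> lambda1 T R <= lambda1 T' R.

Definition tree_class (n m : nat) (T : sgraph) : Prop :=
  [/\ is_tree T, #|T| = n & matching_number T = m].

(* The complete bipartite graph K_{a,b}. *)
Definition Kbip_adj (a b : nat) : rel ('I_a + 'I_b)%type :=
  fun x y => match x, y with
             | inl _, inr _ | inr _, inl _ => true
             | _, _ => false
             end.

Lemma Kbip_adj_sym a b : symmetric (@Kbip_adj a b).
Proof. by case=> x [] y. Qed.

Lemma Kbip_adj_irrefl a b : irreflexive (@Kbip_adj a b).
Proof. by case. Qed.

Definition Kbip (a b : nat) : sgraph :=
  SGraph (@Kbip_adj_sym a b) (@Kbip_adj_irrefl a b).

(* The tree T(p,q,b), meant for 2 <= q <= b. The vertex [inl i] is u_{i+1}, and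
   [inr j] is the j-th pendant vertex, attached to u_{pendant_base p q j + 1}:
   j = 0 hangs from u_1, j = 1, ..., q-2 from u_{p+2}, ..., u_{p+q-1}, and the
   b+1-q remaining indices j = q-1, ..., b-1 from u_{p+q}. *)
Definition pendant_base (p q j : nat) : nat :=
  if j == 0%N then 0%N else if (j <= q - 2)%N then (p + j)%N else (p + q - 1)%N.

Definition Tpqb_adj (p q b : nat) : rel ('I_(p + q) + 'I_b)%type :=
  fun x y => match x, y with
             | inl i, inl k => (i.+1 == k :> nat) || (k.+1 == i :> nat)
             | inl i, inr j => i == pendant_base p q j :> nat
             | inr j, inl i => i == pendant_base p q j :> nat
             | inr _, inr _ => false
             end.

Lemma Tpqb_adj_sym p q b : symmetric (@Tpqb_adj p q b).
Proof. by case=> x [] y //=; rewrite orbC. Qed.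

Lemma Tpqb_adj_irrefl p q b : irreflexive (@Tpqb_adj p q b).
Proof. by case=> x //=; rewrite orbb gtn_eqF. Qed.

Definition Tpqb (p q b : nat) : sgraph :=
  SGraph (@Tpqb_adj_sym p q b) (@Tpqb_adj_irrefl p q b).

(* Main.v *)
(* Let the tree G have n vertices and at most K = p + 2 interior ones, and
   let f >= 0 be its first Dirichlet eigenfunction. List K vertices, among
   them all the interior ones, in increasing order of f, with values a_1 <=
   ... <= a_K, and put a_0 = 0 and e_l = a_(l+1) - a_l. An edge between the
   levels i < j contributes (e_i + ... + e_(j-1))^2 to the energy, which is
   at least the sum of the e_l^2 plus twice the products of consecutive e_l.
   A nonempty set S of interior vertices of a tree has, for every vertex w
   outside S, an edge leaving S to a vertex other than w; so at least two
   edges cross every gap e_l, at least one crosses both e_l and e_(l+1), and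
   all the leaf edges cross e_0 (which is 0 if G has fewer than K interior
   vertices). The resulting lower bound is exactly the energy of the comet
   T(p, 2, n - K) with the values a_j placed alternately from the two ends
   of its path towards the middle. Hence the comet minimizes lambda_1. In
   the equality case the rearranged function is an eigenfunction of the
   comet; if the comet has at least three leaves, all the gaps e_l are then
   positive, which forces the crossing numbers to be minimal and determines
   G. Finally, a tree with matching number m has at most 2m - 1 interior
   vertices, and at most 2m - 2 if n = 2m. *)

Require Import Defs.
From HB Require Import structures.
From mathcomp Require Import all_boot all_order all_algebra.
From mathcomp Require Import all_classical all_reals.
From mathcomp Require Import topology normedtype derive.
From mathcomp Require Import zify ring lra.

Set Implicit Arguments.
Unset Strict Implicit.
Unset Printing Implicit Defensive.

Import Order.TTheory GRing.Theory Num.Theory.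

Local Open Scope nat_scope.

(** * Acyclic graphs *)

Section Acyclic.
Variable G : sgraph.
Hypothesis acG : acyclic_graph G.
Implicit Types (X S : {set G}) (x y v w : G) (p : seq G).

Definition nbrs X x : {set G} := [set y in X | adj x y].

Lemma adjC x y : adj x y = adj y x.
Proof. exact: adj_sym. Qed.

Lemma in_nbrs X x y : (y \in nbrs X x) = (y \in X) && adj x y.
Proof. by rewrite inE. Qed.

Lemma nbrsT x : #|nbrs [set: G] x| = degree x.
Proof. by apply: eq_card => y; rewrite !inE. Qed.

(** An edge from [x] to a vertex of the path beyond [z] would close a cycle of length at least 3. *)
Lemma path_chordless x z p :
    path (@adj G) x (z :: p) -> uniq (x :: z :: p) ->
  forall w, w \in x :: z :: p -> adj x w -> w = z.
Proof.
move=> xzp uxzp w; rewrite inE => /predU1P[->|]; first by rewrite adj_irrefl.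
rewrite inE => /predU1P[-> //|wp] xw; case/splitPr: wp xzp uxzp => p1 p2 xzp uxzp.
case: (acG (c := x :: z :: rcons p1 w)); first by rewrite /= size_rcons.
move: xzp uxzp; rewrite -cat_rcons -!cat_cons cat_uniq cat_path.
case/andP=> xzp _ /andP[uxzp _]; rewrite /ucycle uxzp andbT.
by rewrite (cycle_path x) /= last_rcons (adjC w) xw; case/andP: xzp => ->.
Qed.

(** The path grows at its first vertex, so its last vertex is kept. If the first vertex has two
    neighbors in [X], at most one of them lies on the path by [path_chordless], and the other one
    can be prepended. The size of [X] bounds the growth. *)
Lemma path_to_end X x p :
    path (@adj G) x p -> uniq (x :: p) -> {subset x :: p <= X} ->
  exists y q, [/\ path (@adj G) y q, uniq (y :: q), {subset y :: q <= X},
    size p <= size q /\ last y q = last x p & #|nbrs X y| <= 1].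
Proof.
have [n] := ubnP (#|X| - size p); elim: n x p => // n IHn x p ltn xp uxp sxpX.
have [nx|nx] := leqP #|nbrs X x| 1; first by exists x, p.
have [w wX wxp] : exists2 w, w \in nbrs X x & w \notin x :: p.
  case: p xp uxp sxpX {ltn} => [|z p] xp uxp sxpX.
    have /card_gt0P[w wX] : 0 < #|nbrs X x| by exact: ltnW.
    exists w => //; move: wX; rewrite !inE => /andP[_]; apply: contraL => /eqP->.
    by rewrite adj_irrefl.
  have /card_gt1P[w1 [w2 [w1X w2X w12]]] := nx.
  have [] := boolP (w1 \in x :: z :: p); last by exists w1.
  have [] := boolP (w2 \in x :: z :: p); last by exists w2.
  move: w1X w2X; rewrite !in_nbrs => /andP[_ a1] /andP[_ a2].
  move=> /(path_chordless xp uxp)/(_ a2) e2 /(path_chordless xp uxp)/(_ a1) e1.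
  by rewrite e1 e2 eqxx in w12.
move: wX; rewrite in_nbrs => /andP[wX xw].
have swX : {subset [:: w, x & p] <= X}.
  by move=> u; rewrite inE => /predU1P[->|/sxpX].
have uw : uniq [:: w, x & p] by rewrite cons_uniq wxp.
have ltpX : size p < #|X|.
  have /(uniq_leq_size (s2 := enum X)) : uniq (x :: p) by [].
  rewrite -cardE; apply => u /sxpX; by rewrite mem_enum.
have ltn' : #|X| - size (x :: p) < n by rewrite /=; lia.
have wxp' : path (@adj G) w (x :: p) by rewrite /= adjC xw.
have [y [q [yq uyq sX [le e] ny]]] := IHn w (x :: p) ltn' wxp' uw swX.
by exists y, q; split=> //; split=> //; exact: ltnW.
Qed.

(** The induction principle for forests: a vertex other than the root [v] can be stripped off. It is
    the end of a longest path that starts with an edge at [v], or of one starting at [x] if [v] has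
    no neighbor in [X]; such a path cannot end in [v]. *)
Lemma acyclic_peel X v x : x \in X -> x != v ->
  exists s, [/\ s \in X, s != v & #|nbrs X s| <= 1].
Proof.
move=> xX xv.
have [/existsP[w /and3P[vX wX vw]]|noe] :=
    boolP [exists w, [&& v \in X, w \in X & adj v w]].
  have [|||y [q [yq uyq sX [le e] ny]]] := @path_to_end X w [:: v].
  - by rewrite /= adjC vw.
  - by rewrite /= inE !andbT; apply: contraL vw => /eqP->; rewrite adj_irrefl.
  - by move=> u; rewrite !inE => /orP[/eqP->|/eqP->].
  exists y; split => //; first by apply: sX; rewrite inE eqxx.
  case: q yq uyq sX le e => // z q yq uyq sX le /= e.
  apply/eqP => eyv; move: uyq; rewrite cons_uniq eyv.
  by rewrite -[X in X \notin _]e mem_last.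
have [|||y [q [yq uyq sX [le e] ny]]] := @path_to_end X x [::] => //.
  by move=> u; rewrite !inE => /eqP->.
exists y; split=> //; first by apply: sX; rewrite inE eqxx.
apply/eqP => eyv; case: q yq uyq sX le e => [|z q] /=.
  by move=> _ _ _ _ e; rewrite -e eyv eqxx in xv.
case/andP=> yz _ _ sX _ _; case/existsP: noe; exists z.
by rewrite -eyv yz !sX ?inE ?eqxx ?orbT.
Qed.

(** Peel a vertex [s] other than [v] off [v |: S]: it has at most one neighbor there but degree at
    least 2. All lower bounds on crossing edges come from this. *)
Lemma exit_edge S v x : x \in S -> v \notin S ->
    (forall s, s \in S -> 1 < degree s) ->
  exists s w, [/\ s \in S, w \notin S, w != v & adj s w].
Proof.
move=> xS vS degS.
have xv : x != v by apply: contraNneq vS => <-.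
have [|s [sX sv ns]] := @acyclic_peel (v |: S) v x _ xv; first by rewrite inE xS orbT.
have sS : s \in S by move: sX; rewrite !inE (negPf sv).
have : ~~ (nbrs [set: G] s \subset nbrs (v |: S) s).
  apply: contraL ns => /subset_leq_card; rewrite nbrsT -ltnNge.
  exact/leq_trans/degS.
case/subsetPn=> w; rewrite !inE /= => sw; rewrite sw andbT negb_or => /andP[wv wS].
by exists s, w; split.
Qed.

(** A forest has fewer edges than vertices; peeling off [s] lowers the degree sum by twice its
    degree in [X], which is at most 2. *)
Lemma sum_nbrs_le X : X != finset.set0 -> \sum_(x in X) #|nbrs X x| + 2 <= 2 * #|X|.
Proof.
have [n] := ubnP #|X|; elim: n X => // n IHn X ltX /set0Pn[v vX].
have [->|] := eqVneq X [set v].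
  rewrite big_set1 cards1 (_ : nbrs _ _ = finset.set0) ?cards0 //.
  by apply/finset.setP => y; rewrite !inE; case: eqP => // ->; rewrite adj_irrefl.
rewrite finset.eqEsubset finset.sub1set vX andbT => /subsetPn[x xX]; rewrite inE => xv.
have [s [sX sv ns]] := acyclic_peel xX xv.
have X'0 : X :\ s != finset.set0.
  by apply/set0Pn; exists v; rewrite !inE vX eq_sym sv.
have cX : #|X| = #|X :\ s|.+1 by rewrite (cardsD1 s X) sX.
have := IHn (X :\ s); rewrite -ltnS -cX => /(_ ltX X'0).
rewrite (big_setD1 s sX) /= cX.
suff -> : \sum_(x in X :\ s) #|nbrs X x| =
    \sum_(x in X :\ s) #|nbrs (X :\ s) x| + #|nbrs X s| by lia.
transitivity (\sum_(x in X :\ s) (#|nbrs (X :\ s) x| + adj s x)).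
  apply: eq_bigr => y _; rewrite (cardsD1 s (nbrs X y)) in_nbrs sX adjC addnC.
  by congr (_ + _); apply: eq_card => z; rewrite !inE andbA.
rewrite big_split /=; congr (_ + _); rewrite -big_mkcondr /= sum1_card.
apply: eq_card => y; rewrite !inE unfold_in /= !inE.
by case: eqP => //= ->; rewrite adj_irrefl andbF.
Qed.

End Acyclic.

(** * Trees and matchings *)

Section Tree.
Variable G : sgraph.
Implicit Types (X S : {set G}) (x y v w : G).
Hypothesis trG : is_tree G.

Lemma tree_acyclic : acyclic_graph G. Proof. by case: trG. Qed.

Lemma tree_connected x y : connect (@adj G) x y. Proof. by case: trG => _ /(_ x y). Qed.

Lemma closed_setT X x : x \in X ->
  (forall y z, y \in X -> adj y z -> z \in X) -> X = [set: G].
Proof.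
move=> xX clX; apply/finset.setP => y; rewrite inE.
have cl : fingraph.closed (@adj G) [in X].
  move=> u v uv; apply/idP/idP => h; first exact: (clX _ _ h uv).
  by apply: (clX _ _ h); rewrite adjC.
by rewrite -(closed_connect cl (tree_connected x y)).
Qed.

Lemma degree_gt0 x : 1 < #|G| -> 0 < degree x.
Proof.
rewrite lt0n => lt1; apply: contraTneq lt1 => d0; rewrite -leqNgt -cardsT.
rewrite -(closed_setT (finset.set11 x)) ?cards1 // => y z /set1P-> xz.
by move/eqP: d0; rewrite cards_eq0 => /eqP/finset.setP/(_ z); rewrite !inE xz.
Qed.

Lemma leavesP x : reflect (degree x = 1) (x \in leaves G).
Proof. by rewrite inE; exact: eqP. Qed.

Lemma in_inner x : (x \in inner G) = (x \notin leaves G).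
Proof. by rewrite inE. Qed.

Lemma inner_degree x : 1 < #|G| -> x \in inner G -> 1 < degree x.
Proof.
by move=> lt1; rewrite in_inner inE; have := degree_gt0 x lt1; case: degree => [|[]].
Qed.

Lemma leaf_nbr x : x \in leaves G -> exists y, forall z, adj x z = (z == y).
Proof.
move/leavesP/eqP/cards1P => [y e]; exists y => z.
by have /finset.setP/(_ z) := e; rewrite !inE.
Qed.

(** Two adjacent leaves would form a whole component. *)
Lemma leaf_nbr_inner x y : 2 < #|G| -> x \in leaves G -> adj x y -> y \in inner G.
Proof.
move=> lt2 xl xy; rewrite in_inner; apply/negP => yl.
have [x' ex] := leaf_nbr xl; have [y' ey] := leaf_nbr yl.
have exy : y = x' by apply/eqP; rewrite -ex.
have eyx : x = y' by apply/eqP; rewrite -ey adjC.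
suff e : [set x; y] = [set: G].
  by move: lt2; rewrite -cardsT -e cards2; case: eqP.
apply: (closed_setT (x := x)); first by rewrite !inE eqxx.
move=> u v; rewrite !inE => /orP[/eqP->|/eqP->]; rewrite ?ex ?ey => /eqP->.
  by rewrite exy eqxx orbT.
by rewrite eyx eqxx.
Qed.

(** Peeling yields a leaf; peeling with that leaf as the forbidden vertex yields another one. *)
Lemma leaves_gt1 : 1 < #|G| -> 1 < #|leaves G|.
Proof.
move=> lt1; have /card_gt1P[u [v [_ _ uv]]] := lt1.
have leafP s : #|nbrs [set: G] s| <= 1 -> s \in leaves G.
  by rewrite nbrsT => le1; rewrite inE eqn_leq le1 degree_gt0.
have [|s [_ _ /leafP sl]] := acyclic_peel tree_acyclic (X := [set: G]) _ uv => //.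
have [t ts] : exists t, t != s.
  have [us|us] := eqVneq u s; last by exists u.
  by exists v; rewrite -us eq_sym.
have [|t' [_ t's /leafP tl]] := acyclic_peel tree_acyclic (X := [set: G]) _ ts => //.
by apply/card_gt1P; exists t', s.
Qed.

Lemma inner_exists : 2 < #|G| -> exists x, x \in inner G.
Proof.
move=> lt2; have /ltnW/card_gt0P[x xl] := leaves_gt1 (ltnW lt2).
have [y ey] := leaf_nbr xl; exists y; apply: leaf_nbr_inner (xl) _ => //.
by rewrite ey.
Qed.

Lemma card_inner : #|inner G| = #|G| - #|leaves G|.
Proof. by rewrite cardsCs finset.setCK. Qed.

End Tree.

Section Matching.
Variable G : sgraph.
Implicit Types (X : {set G}) (x y : G) (M : {set {set G}}).

Lemma in_edge_set (e : {set G}) :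
  reflect (exists x y, adj x y /\ e = [set x; y]) (e \in edge_set G).
Proof.
apply: (iffP imsetP) => [[[x y]]|[x [y [xy ->]]]].
  by rewrite inE /= => xy ->; exists x, y.
by exists (x, y); rewrite ?inE.
Qed.

Lemma matching_number_le k :
  (forall M, is_matching M -> #|M| <= k) -> matching_number G <= k.
Proof. by move=> leM; apply/bigmax_leqP. Qed.

Lemma matching_number_ge M : is_matching M -> #|M| <= matching_number G.
Proof. exact: (@leq_bigmax_cond _ (@is_matching G) (fun M => #|M|)). Qed.

(** Disjoint edges have distinct representatives in a vertex cover. *)
Lemma matching_number_cover (C : {set G}) :
  (forall x y, adj x y -> (x \in C) || (y \in C)) -> matching_number G <= #|C|.
Proof.
move=> covC; apply: matching_number_le => M /andP[/fintype.subsetP subM triv].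
pose f (e : {set G}) := [pick x in e :&: C].
have fP e : e \in M -> exists x, [/\ f e = Some x, x \in e & x \in C].
  move=> eM; rewrite /f; case: pickP => [x|noC].
    by rewrite inE => /andP[xe xC]; exists x.
  have /in_edge_set[x [y [xy ee]]] := subM _ eM.
  have := noC x; have := noC y; have := covC _ _ xy.
  by rewrite ee !inE !eqxx orbT /= => /orP[] ->.
have <- : #|f @: M| = #|M|.
  apply: card_in_imset => e1 e2 e1M e2M ef.
  have [x [ex xe1 _]] := fP _ e1M; have [y [ey ye2 _]] := fP _ e2M.
  have exy : x = y by move: ex; rewrite ef ey => -[].
  apply: contraTeq ye2 => ne; rewrite -exy.
  by have /finset.trivIsetP/(_ _ _ e1M e2M ne)/disjointFr -> := triv.
have <- : #|Some @: C| = #|C| by apply: card_imset => ? ? [].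
apply/subset_leq_card/fintype.subsetP => _ /imsetP[e eM ->].
by have [x [-> _ xC]] := fP _ eM; exact: imset_f.
Qed.

Lemma double_matching_number_le : 2 * matching_number G <= #|G|.
Proof.
rewrite mulnC -leq_divRL //; apply: matching_number_le => M /andP[/fintype.subsetP subM].
rewrite leq_divRL // /finset.trivIset -sum_nat_const => /eqP e.
apply: leq_trans (max_card (mem (finset.cover M))); rewrite -e; apply: leq_sum => A /subM.
by case/in_edge_set => x [y [xy ->]]; rewrite cards2; case: eqP xy => // ->;
  rewrite adj_irrefl.
Qed.

(* A finite forest rooted at [r] has a proper 2-coloring and a choice of a
   child for every vertex that has one: the edges from the vertices of one
   color to their chosen children are pairwise disjoint. *)
Lemma forest_children (acG : acyclic_graph G) r X : r \in X ->
  exists (c : G -> G) (col : G -> bool),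
    let A := [set x in X | (x != r) < #|nbrs X x|] in
    [/\ {in A, forall x, adj x (c x) && (c x \in X)}, {in A &, injective c}
      & {in X &, forall x y, adj x y -> col x != col y}].
Proof.
have [n] := ubnP #|X|; elim: n X => // n IHn X ltX rX.
have [->|] := eqVneq X [set r].
  exists id, (fun=> true) => A.
  have A0 x : x \in A = false.
    rewrite !inE; case: eqP => //= ->;
      rewrite ?eqxx (_ : nbrs _ _ = finset.set0) ?cards0 //.
    by apply/finset.setP => y; rewrite !inE; case: eqP => // ->; rewrite adj_irrefl.
  split=> [x|x y|x y]; rewrite ?A0 // !inE => /eqP-> /eqP->.
  by rewrite adj_irrefl.
rewrite finset.eqEsubset finset.sub1set rX andbT => /subsetPn[x xX]; rewrite inE => xr.
have [s [sX sr ns]] := acyclic_peel acG xX xr.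
have ltX' : #|X :\ s| < n by rewrite -ltnS (leq_trans _ ltX) // [#|X|](cardsD1 s) sX.
have [|c' [col' [adj' inj' colP]]] := IHn _ ltX'; first by rewrite !inE eq_sym sr.
set A' := [set _ in _ | _] in adj' inj'.
have ns1 x1 x2 : x1 \in X -> x2 \in X -> adj x1 s -> adj x2 s -> x1 = x2.
  move=> x1X x2X a1 a2; have /card_le1_eqP := ns.
  by apply; rewrite !in_nbrs adjC ?x1X ?x2X.
pose c x := if x \in A' then c' x else s.
(* The peeled vertex [s] has at most one neighbor in [X] and receives the opposite color. *)
pose col x := if x == s then (if [pick y in nbrs X s] is Some y then ~~ col' y else true)
              else col' x.
exists c, col => A.
(* Membership in [A] asks for two neighbors, one of them the parent, or for one neighbor at the
   root. Deleting [s] only changes the count of a neighbor of [s], so a vertex that is new in [A]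
   can take [s] as its child. *)
have newP y : y \in A -> y \notin A' -> y != s /\ adj y s.
  move=> yA yA'; have yX : y \in X by move: yA; rewrite inE => /andP[].
  have ys : y != s.
    by apply: contraTneq yA => ->; rewrite inE sX sr /= -leqNgt.
  split=> //; apply: contraNT yA' => nys; rewrite inE in_setD1 ys yX /=.
  move: yA; rewrite inE yX /= => /leq_trans; apply; apply: subset_leq_card.
  apply/fintype.subsetP => z; rewrite !inE => /andP[-> yz]; rewrite yz !andbT.
  by apply: contraNneq nys => <-.
split=> [y yA|y z yA zA|y z yX zX yz].
- rewrite /c; case: ifPn => [/adj'/andP[->]|/(newP _ yA)[_ ->]//].
  by rewrite !inE => /andP[].
- have cs u : u \in A' -> c' u <> s by move/adj'/andP => [_];
    rewrite in_setD1 => /andP[/eqP].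
  have [yX zX] : y \in X /\ z \in X by move: yA zA; rewrite !inE => /andP[-> _] /andP[-> _].
  rewrite /c; case: ifPn => [yA'|/(newP _ yA)[_ ys]];
    case: ifPn => [zA'|/(newP _ zA)[_ zs]].
  + exact: inj'.
  + by move/cs: yA'.
  + by move/cs: zA' => + /esym.
  + by move=> _; exact: ns1.
have pickE u : u \in X -> adj u s -> [pick y in nbrs X s] = Some u.
  move=> uX us; case: pickP => [v|/(_ u)]; last by rewrite in_nbrs uX adjC us.
  by rewrite in_nbrs adjC => /andP[vX vs]; congr Some; exact: ns1.
rewrite /col; have [ys|ys] := eqVneq y s; have [zs|zs] := eqVneq z s.
- by rewrite ys zs adj_irrefl in yz.
- have zs' : adj z s by rewrite -ys adjC.
  by rewrite (pickE z zX zs'); case: (col' z).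
- have ys' : adj y s by rewrite -zs.
  by rewrite (pickE y yX ys'); case: (col' y).
by apply: colP => //; rewrite in_setD1 ?ys ?zs.
Qed.

(** Root the tree at a leaf [r]. The vertices that have a child are [r] and the inner vertices, and
    the edges to the chosen children split by color into two matchings. *)
Lemma inner_lt_double_matching_number :
  is_tree G -> 1 < #|G| -> #|inner G| < 2 * matching_number G.
Proof.
move=> trG lt1; have /ltnW/card_gt0P[r rl] := leaves_gt1 trG lt1.
have [c [col [adjc injc colP]]] := forest_children (tree_acyclic trG) (finset.in_setT r).
set A := [set _ in _ | _] in adjc injc.
have cA : #|A| = #|inner G|.+1.
  have <- : r |: inner G = A.
    apply/finset.setP => x; rewrite in_setU1 [RHS]inE finset.in_setT nbrsT /=.
    have [->|xr] /= := eqVneq x r; first by rewrite degree_gt0.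
    apply/idP/idP => [/inner_degree -> //|]; rewrite in_inner inE.
    by apply: contraTneq => ->.
  by rewrite cardsU1 in_inner rl.
clearbody A.
have colc x : x \in A -> col x != col (c x).
  by case/adjc/andP => xc _; apply: colP; rewrite ?finset.in_setT.
(* A vertex shared as parent of one edge and child of the other would have both colors; as a common
   child it is excluded by the injectivity of [c]. *)
have edge_eq x y z : x \in A -> y \in A -> col x = col y ->
    z \in [set x; c x] -> z \in [set y; c y] -> x = y.
  move=> xA yA cxy; rewrite !inE.
  have := colc _ xA; have := colc _ yA.
  move=> cy cx /orP[]/eqP-> /orP[]/eqP // e.
  - by move: cy; rewrite -cxy e eqxx.
  - by move: cx; rewrite cxy -e eqxx.
  by apply: injc; rewrite ?finset.in_setT.
have matM b : #|[set x in A | col x == b]| <= matching_number G.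
  rewrite -(card_in_imset (f := fun x => [set x; c x])).
    apply: matching_number_ge; apply/andP; split.
      apply/fintype.subsetP => _ /imsetP[x + ->]; rewrite inE => /andP[/adjc/andP[xc _] _].
      by apply/in_edge_set; exists x, (c x).
    apply/finset.trivIsetP => _ _ /imsetP[x + ->] /imsetP[y + ->].
    rewrite !inE => /andP[xA /eqP cx] /andP[yA /eqP cy] ne.
    rewrite -setI_eq0; apply/set0Pn => -[z]; rewrite inE => /andP[zx zy].
    have cxy : col x = col y by rewrite cx cy.
    by case/eqP: ne; rewrite (edge_eq x y z xA yA cxy zx zy).
  move=> x y; rewrite !inE => /andP[xA /eqP cx] /andP[yA /eqP cy] e.
  by apply: (edge_eq x y x) => //; rewrite ?cx ?cy // -?e !inE eqxx.
have : #|A| <= #|[set x in A | col x == true]| + #|[set x in A | col x == false]|.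
  rewrite -cardsUI; apply: leq_trans (leq_addr _ _); apply/subset_leq_card.
  by apply/fintype.subsetP => x xA; rewrite !inE xA; case: (col x).
rewrite cA => /leq_trans; apply; rewrite mul2n -addnn; exact: leq_add.
Qed.

End Matching.

(* Look at the two neighbors on a cycle of its vertex of least rank. *)
Lemma ranked_acyclic (G : sgraph) (rk : G -> nat) :
  (forall x y z, adj x y -> adj x z -> rk x <= rk y -> rk x <= rk z -> y = z) ->
  acyclic_graph G.
Proof.
move=> rkP c szc ucyc.
have [x0 x0c] : exists x, x \in c by case: c szc {ucyc} => // x c _; exists x;
  rewrite inE eqxx.
pose x := [arg min_(i < x0 in c) rk i].
have [xc xmin] : x \in c /\ forall y, y \in c -> rk x <= rk y.
  by rewrite /x; case: arg_minnP => // y yc ymin; split.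
have [i q ci] := rot_to xc.
have : ucycle (@adj G) (x :: q) by rewrite -ci rot_ucycle.
have sq : {subset q <= c} by move=> y yq; rewrite -(mem_rot i) ci inE yq orbT.
have : 1 < size q by rewrite -ltnS -[(size q).+1]/(size (x :: q)) -ci size_rot.
case: q {ci} sq => [//|y q]; case/lastP: q => [//|q z] sq _ /andP[].
rewrite (cycle_path x) /= last_rcons => /and3P[zx xy _] /andP[_ /andP[+ _]].
have yc : y \in c by apply: sq; rewrite inE eqxx.
have zc : z \in c by apply: sq; rewrite inE mem_rcons inE eqxx orbT.
by rewrite (rkP x y z) ?xmin ?mem_rcons ?inE ?eqxx // adjC.
Qed.

(** * The Rayleigh quotient *)

Section SumContinuous.
Import numFieldNormedType.Exports.
Local Open Scope ring_scope.

Lemma continuous_bigsum (R : realType) (U : topologicalType) (I : Type) (r : seq I)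
    (P : pred I) (F : I -> U -> R) :
  (forall i, continuous (F i)) -> continuous (fun u => \sum_(i <- r | P i) F i u).
Proof.
move=> cF; elim: r => [|i r IHr] u.
  by under eq_fun do rewrite big_nil; exact: cst_continuous.
under eq_fun do rewrite big_cons.
case: (P i); last exact: IHr.
by apply: (@cvgD _ _ _ _ _ (F i) _ (F i u)); [exact: cF|exact: IHr].
Qed.

End SumContinuous.

Section Rayleigh.
Import numFieldNormedType.Exports.
Local Open Scope ring_scope.
Variables (R : realType) (G : sgraph).
Implicit Types (f g h : {ffun G -> R}) (x y : G) (l : R).

Definition dirichlet (f : G -> R) : Prop := forall x, x \in leaves G -> f x = 0.

(* A sum over ordered pairs: every edge is counted twice. *)
Definition energy2 (f g : G -> R) : R :=
  \sum_x \sum_(y | adj x y) (f x - f y) * (g x - g y).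

Definition sqnorm (f : G -> R) : R := \sum_x f x ^+ 2.

(** Green's formula: exchanging the two ends of an edge in the terms with [g y] doubles those with
    [g x]. *)
Lemma energy2E f g : energy2 f g = 2 * \sum_x g x * - laplacian f x.
Proof.
have -> : energy2 f g = \sum_x \sum_(y | adj x y) (f x - f y) * g x -
    \sum_x \sum_(y | adj x y) (f x - f y) * g y.
  rewrite -sumrB; apply: eq_bigr => x _; rewrite -sumrB; apply: eq_bigr => y _.
  by rewrite mulrBr.
rewrite [X in _ - X](exchange_big_dep predT) //= -sumrB mulr_sumr.
apply: eq_bigr => x _.
have -> : \sum_(i | adj i x) (f i - f x) * g x = - (\sum_(y | adj x y) (f x - f y) * g x).
  rewrite -sumrN; apply: eq_big => [y|y _]; first by rewrite adjC.
  by rewrite -mulNr opprB.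
have -> : - laplacian f x = \sum_(y | adj x y) (f x - f y).
  by rewrite /laplacian -sumrN; apply: eq_bigr => y _; rewrite opprB.
by rewrite -mulr_suml; ring.
Qed.

Lemma energy2_ge0 (f : G -> R) : 0 <= energy2 f f.
Proof. by apply: sumr_ge0 => x _; apply: sumr_ge0 => y _; rewrite -expr2 sqr_ge0. Qed.

Lemma sqnorm_ge0 (f : G -> R) : 0 <= sqnorm f.
Proof. by apply: sumr_ge0 => x _; rewrite sqr_ge0. Qed.

Lemma sqnorm_eq0 f : (sqnorm f == 0) = (f == 0).
Proof.
apply/idP/idP => [|/eqP->]; last first.
  by rewrite /sqnorm big1 // => x _; rewrite ffunE expr0n.
rewrite psumr_eq0 => [/allP f0|x _]; last by rewrite sqr_ge0.
apply/eqP/ffunP => x; rewrite ffunE; apply/eqP; rewrite -sqrf_eq0.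
by apply: f0; rewrite mem_index_enum.
Qed.

Lemma sqnorm_gt0 f : (0 < sqnorm f) = (f != 0).
Proof. by rewrite lt_def sqnorm_ge0 andbT sqnorm_eq0. Qed.

Lemma eigenfunction_energy2 l f : dirichlet f ->
  (forall x, x \in inner G -> - laplacian f x = l * f x) ->
  energy2 f f = 2 * l * sqnorm f.
Proof.
move=> df ef; rewrite energy2E -mulrA; congr (_ * _); rewrite /sqnorm mulr_sumr.
apply: eq_bigr => x _; have [xl|xl] := boolP (x \in leaves G).
  by rewrite df // mul0r expr0n mulr0.
by rewrite ef ?in_inner // expr2 mulrCA.
Qed.

(** The first-order condition at a minimum. The test value [- b / (|c| + 1)] is small enough for the
    linear term to dominate. *)
Lemma quadratic_ge0_linear0 (b c : R) : (forall t, 0 <= t * b + t ^+ 2 * c) -> b = 0.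
Proof.
move=> ge0; apply/eqP/negPn/negP => b0.
have b2 : 0 < b ^+ 2 by rewrite lt_def sqr_ge0 sqrf_eq0 b0.
have c1 : 0 < `|c| + 1 by rewrite ltr_wpDl.
have := ge0 (- b / (`|c| + 1)); apply/negP; rewrite -ltNge.
have -> : - b / (`|c| + 1) * b + (- b / (`|c| + 1)) ^+ 2 * c =
   b ^+ 2 / (`|c| + 1) ^+ 2 * (c - `|c| - 1).
  by field; rewrite gt_eqF.
have p : 0 < b ^+ 2 / (`|c| + 1) ^+ 2 by rewrite divr_gt0 // exprn_gt0.
by rewrite pmulr_rlt0 //; have := ler_norm c; lra.
Qed.

(** Vary [f] by [t] times the indicator [h] of [x], which is admissible because [x] is interior. The
    linear coefficient of the defect is [4 * (- laplacian f x - l * f x)]. *)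
Lemma minimizer_eigenfunction l f : dirichlet f ->
  energy2 f f <= 2 * l * sqnorm f ->
  (forall h, dirichlet h -> 2 * l * sqnorm h <= energy2 h h) ->
  forall x, x \in inner G -> - laplacian f x = l * f x.
Proof.
move=> df fle minl x xi; have fE : energy2 f f = 2 * l * sqnorm f by apply/le_anti;
  rewrite fle minl.
pose h : {ffun G -> R} := [ffun y => (y == x)%:R].
have dh : dirichlet h.
  by move=> y yl; rewrite ffunE; case: eqP yl => // ->;
    rewrite -[_ \in _]negbK -in_inner xi.
pose k t : {ffun G -> R} := [ffun y => f y + t * h y].
have dk t : dirichlet (k t) by move=> y yl; rewrite ffunE df // dh // mulr0 addr0.
have ek t : energy2 (k t) (k t) =
    energy2 f f + t * (2 * energy2 f h) + t ^+ 2 * energy2 h h.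
  rewrite /energy2 !mulr_sumr -!big_split /=; apply: eq_bigr => y _.
  by rewrite !mulr_sumr -!big_split /=; apply: eq_bigr => z _; rewrite !ffunE; ring.
have sk t : sqnorm (k t) = sqnorm f + t * (2 * f x) + t ^+ 2 * sqnorm h.
  have -> : f x = \sum_y f y * h y.
    rewrite (bigD1 x) //= ffunE eqxx mulr1 big1 ?addr0 // => y /negPf yx.
    by rewrite ffunE yx mulr0.
  rewrite /sqnorm !mulr_sumr -!big_split /=; apply: eq_bigr => y _.
  by rewrite ffunE; ring.
have hE : energy2 f h = 2 * - laplacian f x.
  rewrite energy2E; congr (_ * _).
  rewrite (bigD1 x) //= ffunE eqxx mul1r big1 ?addr0 // => y /negPf yx.
  by rewrite ffunE yx mul0r.
suff : 4 * (- laplacian f x - l * f x) = 0 by lra.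
apply: (@quadratic_ge0_linear0 _ (energy2 h h - 2 * l * sqnorm h)) => t.
by have := minl _ (dk t); rewrite ek sk fE hE; lra.
Qed.

(** The energy is continuous on the compact unit sphere of Dirichlet functions, and both sides are
    homogeneous of degree 2 in [h]. *)
Lemma rayleigh_minimizer x0 : x0 \in inner G ->
  exists f, [/\ dirichlet f, sqnorm f = 1 &
    forall h, dirichlet h -> energy2 f f * sqnorm h <= energy2 h h].
Proof.
(* Functions on [G] are identified with row vectors, where closed bounded sets are compact. *)
move=> x0i; pose n := #|G|.
pose F (v : 'rV[R]_n) : {ffun G -> R} := [ffun x => v ord0 (enum_rank x)].
pose V (f : {ffun G -> R}) : 'rV[R]_n := \row_i f (enum_val i).
have FV f : F (V f) = f by apply/ffunP => x; rewrite ffunE mxE enum_rankK.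
have cc x : continuous (fun v : 'rV[R]_n => F v x).
  move=> v; under eq_fun do rewrite ffunE; exact: coord_continuous.
have cB x y : continuous (fun v : 'rV[R]_n => F v x - F v y).
  by move=> v; exact: (cvgB (cc x v) (cc y v)).
have csq : continuous (fun v => sqnorm (F v)).
  apply: continuous_bigsum => x v; under eq_fun do rewrite expr2.
  exact: (cvgM (cc x v) (cc x v)).
have cen : continuous (fun v => energy2 (F v) (F v)).
  apply: continuous_bigsum => x; apply: continuous_bigsum => y v.
  exact: (cvgM (cB x y v) (cB x y v)).
pose A := [set v | sqnorm (F v) = 1 /\ dirichlet (F v)]%classic.
have scaleF t f : sqnorm [ffun x => t * f x] = t ^+ 2 * sqnorm f.
  by rewrite /sqnorm mulr_sumr; apply: eq_bigr => x _; rewrite ffunE exprMn.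
have A0 : (A !=set0)%classic.
  exists (V [ffun y => (y == x0)%:R]); rewrite /A /= FV; split.
    rewrite /sqnorm (bigD1 x0) //= ffunE eqxx expr1n big1 ?addr0 // => y /negPf yx.
    by rewrite ffunE yx expr0n.
  move=> y yl; rewrite ffunE; case: eqP yl => // ->.
  by rewrite -[_ \in _]negbK -in_inner x0i.
have cA : compact A.
  apply: bounded_closed_compact.
    exists 1; split; first exact: num_real.
    move=> M ltM v [v1 _]; apply: le_trans (ltW ltM).
    rewrite [leLHS]/Num.norm /= mx_normrE; apply: bigmax_le => // -[i j] _ /=.
    rewrite -(@ler_pXn2r _ 2) ?nnegrE // expr1n real_normK ?num_real //.
    rewrite -[leRHS]v1 /sqnorm (bigD1 (enum_val j)) //= ffunE enum_valK (ord1 i).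
    by rewrite lerDl; apply: sumr_ge0 => x _; rewrite sqr_ge0.
  rewrite (_ : A = (fun v => sqnorm (F v)) @^-1` [set 1] `&`
      \bigcap_(x in [set` leaves G]) (fun v => F v x) @^-1` [set 0])%classic; last first.
    by apply/seteqP; split=> v [v1 vd]; split.
  apply: closedI; last apply: closed_bigI => x _.
    by apply: preimage_closed => [v _|]; [exact: csq|exact: closed_eq].
  by apply: preimage_closed => [v _|]; [exact: cc|exact: closed_eq].
have [v] := EVT_min_rV A0 cA (continuous_subspaceT cen).
rewrite inE => -[v1 vd] vmin; exists (F v); split => // h dh.
have [->|h0] := eqVneq h 0.
  by rewrite (eqP (_ : sqnorm _ == 0)) ?sqnorm_eq0 // mulr0 energy2_ge0.
pose t := (Num.sqrt (sqnorm h))^-1.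
have t2 : t ^+ 2 * sqnorm h = 1.
  by rewrite exprVn sqr_sqrtr ?sqnorm_ge0 // mulVf // sqnorm_eq0.
have /vmin : (V [ffun x => t * h x]) \in A.
  rewrite inE /A /= FV scaleF t2; split=> // x xl.
  by rewrite ffunE dh // mulr0.
rewrite FV (_ : energy2 [ffun x => t * h x] _ = t ^+ 2 * energy2 h h) => [le|].
  rewrite -(ler_pM2l (_ : 0 < t ^+ 2)); last first.
    by rewrite exprn_gt0 // invr_gt0 sqrtr_gt0 sqnorm_gt0.
  by rewrite mulrCA t2 mulr1.
rewrite /energy2 !mulr_sumr; apply: eq_bigr => x _.
by rewrite !mulr_sumr; apply: eq_bigr => y _; rewrite !ffunE; ring.
Qed.

(** The infimum of the eigenvalues is the minimum of the Rayleigh quotient: a minimizer is an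
    eigenfunction, and every eigenvalue is the quotient of its eigenfunction. The factor 2 is due to
    [energy2] counting each edge twice. *)
Theorem lambda1_min x0 : x0 \in inner G ->
  [/\ exists f, [/\ f != 0, dirichlet f & energy2 f f = 2 * lambda1 G R * sqnorm f]
    & forall h, dirichlet h -> 2 * lambda1 G R * sqnorm h <= energy2 h h].
Proof.
move=> x0i; have [f [df f1 fmin]] := rayleigh_minimizer x0i.
pose l := energy2 f f / 2.
have lE : 2 * l = energy2 f f by rewrite /l; field.
have f0 : f != 0 by rewrite -sqnorm_gt0 f1.
suff -> : lambda1 G R = l by split=> [|h dh]; [exists f;
  rewrite lE f1 mulr1 | rewrite lE fmin].
have lS : [set l | dirichlet_eigenvalue G l]%classic l.
  exists f; split=> // x xi.
  apply: minimizer_eigenfunction xi => //; first by rewrite lE f1 mulr1.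
  by move=> h dh; rewrite lE fmin.
have lbS : lbound [set l | dirichlet_eigenvalue G l]%classic l.
  move=> r [h [h0 eh dh]]; rewrite -sqnorm_gt0 in h0.
  have := fmin _ dh; rewrite (eigenfunction_energy2 dh eh) -lE.
  by rewrite ler_pM2r // ler_pM2l.
apply/le_anti; rewrite lb_le_inf ?andbT //; last by exists l.
by apply: ge_inf => //; exists l.
Qed.

Lemma lambda1_le x0 f l : x0 \in inner G -> f != 0 -> dirichlet f ->
  energy2 f f <= 2 * l * sqnorm f -> lambda1 G R <= l.
Proof.
rewrite -sqnorm_gt0 => x0i f0 df fle; have [_ /(_ _ df) min] := lambda1_min x0i.
by have := le_trans min fle; rewrite ler_pM2r // ler_pM2l.
Qed.

(** Passing to the absolute value keeps the norm and, by the reverse triangle inequality, does not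
    increase the energy. *)
Lemma lambda1_eigenfunction_ge0 x0 : x0 \in inner G ->
  exists f, [/\ f != 0, dirichlet f, forall x, 0 <= f x
    & energy2 f f = 2 * lambda1 G R * sqnorm f].
Proof.
move=> x0i; have [[f [f0 df ef]] min] := lambda1_min x0i.
pose g : {ffun G -> R} := [ffun x => `|f x|].
have gf : sqnorm g = sqnorm f.
  by apply: eq_bigr => x _; rewrite ffunE real_normK ?num_real.
have dg : dirichlet g by move=> x xl; rewrite ffunE df // normr0.
exists g; split=> //; first by rewrite -sqnorm_gt0 gf sqnorm_gt0.
  by move=> x; rewrite ffunE.
apply/le_anti; rewrite min // andbT gf -ef; apply: ler_sum => x _; apply: ler_sum => y _.
rewrite !ffunE -!expr2 -[leRHS]real_normK ?num_real // -[leLHS]real_normK ?num_real //.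
by rewrite ler_pXn2r ?nnegrE // ler_dist_dist.
Qed.

End Rayleigh.

(** * Isomorphisms and the zigzag numbering of the comet *)

Section Isomorphism.

Lemma inj_isomorphic (G H : sgraph) (f : G -> H) : #|G| = #|H| -> injective f ->
  (forall x y, adj (f x) (f y) = adj x y) -> isomorphic G H.
Proof. by move=> GH injf adjf; exists f => //; apply: inj_card_bij; rewrite ?GH. Qed.

Lemma isomorphic_sym (G H : sgraph) : isomorphic G H -> isomorphic H G.
Proof.
case=> f [g fK gK] adjf; exists g; first by exists f.
by move=> x y; rewrite -adjf !gK.
Qed.

Lemma isomorphic_trans (G H K : sgraph) :
  isomorphic G H -> isomorphic H K -> isomorphic G K.
Proof.
case=> f bijf adjf [g bijg adjg]; exists (g \o f); first exact: bij_comp.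
by move=> x y /=; rewrite adjg adjf.
Qed.

Lemma isomorphic_eigenvalue (R : realType) (G H : sgraph) (l : R) :
  isomorphic G H -> dirichlet_eigenvalue H l -> dirichlet_eigenvalue G l.
Proof.
case=> f [g fK gK] adjf [h [h0 eh dh]].
have degf x : degree (f x) = degree x.
  rewrite /degree -(card_imset _ (can_inj fK)); apply: eq_card => y.
  apply/idP/imsetP => [|[z + ->]]; rewrite !inE ?adjf // => xy.
  by exists (g y); rewrite ?gK // inE -adjf gK.
exists [ffun x => h (f x)]; split=> [|x xi|x xl].
- apply: contraNneq h0 => /ffunP e; apply/eqP/ffunP => y.
  by have := e (g y); rewrite !ffunE gK => ->.
- rewrite ffunE -eh; last by rewrite !inE degf in xi *.
  congr (- _)%R; rewrite /laplacian. rewrite [RHS](reindex f); last by exists g => y _.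
  by apply: eq_big => [y|y _]; [rewrite adjf|rewrite !ffunE].
- by move: xl; rewrite inE => xl; rewrite ffunE dh // inE degf.
Qed.

Lemma isomorphic_lambda1 (R : realType) (G H : sgraph) :
  isomorphic G H -> lambda1 G R = lambda1 H R.
Proof.
move=> GH; congr inf; apply/seteqP; split=> l /=; apply: isomorphic_eigenvalue => //.
exact: isomorphic_sym.
Qed.

End Isomorphism.

Section Zigzag.
Variables p b : nat.

(** Each half of the path proceeds in steps of 2; for indices below [p + 2] the equation
    [i + k = 2 * p + 1] singles out the middle edge between [p] and [p + 1]. Pendant 0 hangs from
    [inl 1], all the others from [inl 0]. *)
Definition zigzag_adj : rel ('I_(p + 2) + 'I_b)%type := fun x y =>
  match x, y with
  | inl i, inl k => [|| k == i + 2 :> nat, i == k + 2 :> nat | i + k == 2 * p + 1 :> nat]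
  | inl i, inr j | inr j, inl i => i == (j == 0 :> nat) :> nat
  | inr _, inr _ => false
  end.

Lemma zigzag_adj_sym : symmetric zigzag_adj.
Proof. by case=> x [] y //=; rewrite orbCA (addnC (x : nat) y). Qed.

Lemma zigzag_adj_irrefl : irreflexive zigzag_adj.
Proof.
case=> x //=; apply/negP; lia.
Qed.

(* The tree T(p, 2, b) with its interior path renumbered from both ends
   towards the middle: the vertex [inl k] receives the (k+1)-st smallest
   interior value, so [inl 0] is u_(p+2), [inl 1] is u_1, [inl 2] is u_(p+1),
   [inl 3] is u_2, and so on. *)
Definition zigzag : sgraph := SGraph zigzag_adj_sym zigzag_adj_irrefl.

Definition zigzag_pos (k : nat) : nat := if odd k then k./2 else p + 1 - k./2.

Lemma zigzag_pos_ub (k : 'I_(p + 2)) : zigzag_pos k < p + 2.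
Proof. by have := ltn_ord k; rewrite /zigzag_pos; case: ifP; lia. Qed.

Lemma zigzag_isomorphic : isomorphic zigzag (Tpqb p 2 b).
Proof.
pose f (x : zigzag) : Tpqb p 2 b :=
  match x with inl k => inl (Ordinal (zigzag_pos_ub k)) | inr j => inr j end.
apply: (@inj_isomorphic _ _ f) => //.
  case=> [k|j] [k'|j'] //= [e]; congr inl; apply/val_inj => /=.
  by move: e (ltn_ord k) (ltn_ord k'); rewrite /zigzag_pos; do 2 case: ifP; lia.
case=> [k|j] [k'|j'] //=.
- apply/idP/idP; move: (ltn_ord k) (ltn_ord k'); rewrite /zigzag_pos; do 2 case: ifP; lia.
- apply/idP/idP; move: (ltn_ord k); rewrite /pendant_base /zigzag_pos; do ?[case: ifP]; lia.
- apply/idP/idP; move: (ltn_ord k'); rewrite /pendant_base /zigzag_pos;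
    do ?[case: ifP]; lia.
Qed.

End Zigzag.

(** * The comet belongs to the class *)

Lemma degree_gt1 (G : sgraph) (x y z : G) : adj x y -> adj x z -> y != z -> 1 < degree x.
Proof. by move=> xy xz yz; apply/card_gt1P; exists y, z; rewrite !inE. Qed.

Section Comet.
Variables p b : nat.
Hypothesis b2 : 2 <= b.
Let C := Tpqb p 2 b.

Lemma card_comet : #|C| = p + 2 + b.
Proof. by rewrite card_sum !card_ord. Qed.

Lemma comet_acyclic : acyclic_graph C.
Proof.
(* With the pendants at the bottom, only the next path vertex is a neighbor of higher rank. *)
pose rk (x : C) := match x with inl i => i.+1 | inr _ => 0 end.
apply: (@ranked_acyclic _ rk) => -[i|i] [j|j] [k|k] //=; rewrite ?ltnS //.
- by move=> ij ik lij lik; have -> : j = k by apply: val_inj => /=; lia.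
- move=> /eqP ij /eqP ik _ _; have -> // : j = k by apply: val_inj; rewrite /= ij ik.
Qed.

Lemma comet_connected : connected_graph C.
Proof.
have u0 : 0 < p + 2 by rewrite addnS.
suff con0 x : connect (@adj C) (inl (Ordinal u0)) x.
  by move=> x y; apply: connect_trans (con0 y); rewrite (sym_connect_sym (@adj_sym C)).
have path_con i (ltip : i < p + 2) :
  connect (@adj C) (inl (Ordinal u0)) (inl (Ordinal ltip)).
  elim: i ltip => [|i IHi] ltip; first by rewrite (bool_irrelevance ltip u0) connect0.
  by apply: connect_trans (IHi (ltnW ltip)) (connect1 _); rewrite /= eqxx.
case: x => [[i ltip]|j]; first exact: path_con.
have lt : pendant_base p 2 j < p + 2 by rewrite /pendant_base; do ?[case: ifP]; lia.
by apply: connect_trans (path_con _ lt) (connect1 _); rewrite /= eqxx.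
Qed.

Lemma comet_is_tree : is_tree C.
Proof.
split; [by rewrite card_comet; lia | exact: comet_connected | exact: comet_acyclic].
Qed.

(** The upper bound is a vertex cover by every second path vertex, and the lower bound comes from
    the [p + 2] inner vertices. *)
Lemma comet_matching_number : matching_number C = (p + 4)./2.
Proof.
apply/eqP; rewrite eqn_leq; apply/andP; split.
  (* Even positions, capped at [p.+1] so that the last path vertex, which carries pendants, is in
     the cover for either parity of [p]. *)
  have lt (i : 'I_(p + 4)./2) : minn i.*2 p.+1 < p + 2 by lia.
  pose f i : C := inl (Ordinal (lt i)).
  have cov (x : C) : (exists2 i : 'I_(p + 2), x = inl i & ~~ odd i || (i == p.+1 :> nat)) ->
      x \in f @: [set: 'I_(p + 4)./2].
    case=> i xi ei; have li : uphalf i < (p + 4)./2 by have := ltn_ord i; lia.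
    apply/imsetP; exists (Ordinal li) => //; rewrite xi /f; apply: congr1.
    apply: val_inj => /=; have := ltn_ord i; lia.
  have fc : #|f @: [set: 'I_(p + 4)./2]| <= (p + 4)./2.
    by rewrite (leq_trans (leq_imset_card _ _)) // cardsT card_ord.
  apply: leq_trans fc; apply: matching_number_cover => -[i|j] [i'|j'] //= e.
  - have [odi|ei] := boolP (odd i).
      by rewrite [X in _ || X]cov ?orbT //; exists i' => //; move: odi e; lia.
    by rewrite cov //; exists i => //; rewrite ei.
  - by rewrite cov //; exists i => //; move: e; rewrite /pendant_base; do ?[case: ifP]; lia.
  - by rewrite [X in _ || X]cov ?orbT //; exists i' => //; move: e;
      rewrite /pendant_base; do ?[case: ifP]; lia.
have innerC : p + 2 <= #|inner C|.
  rewrite -[p + 2]card_ord -cardsT -(@card_imset _ C inl); last by move=> i j [].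
  apply/subset_leq_card/fintype.subsetP => _ /imsetP[i _ ->]; rewrite in_inner inE neq_ltn.
  apply/orP; right; have ltip := ltn_ord i.
  have [i0|i0] := posnP i.
    have lt1 : 1 < p + 2 by lia.
    by apply: (@degree_gt1 C _ (inl (Ordinal lt1)) (inr (Ordinal (ltnW b2))));
      rewrite //= i0.
  have ltP : i.-1 < p + 2 by lia.
  have [ip|ip] := eqVneq (i : nat) p.+1.
    apply: (@degree_gt1 C _ (inl (Ordinal ltP)) (inr (Ordinal b2))) => //=.
      by rewrite prednK // eqxx orbT.
    by rewrite /pendant_base /=; lia.
  have ltS : i.+1 < p + 2 by lia.
  apply: (@degree_gt1 C _ (inl (Ordinal ltP)) (inl (Ordinal ltS))) => /=.
  - by rewrite prednK // eqxx orbT.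
  - by rewrite eqxx.
  - by apply/eqP => -[]; lia.
have := inner_lt_double_matching_number comet_is_tree; rewrite card_comet => /(_ _); lia.
Qed.

End Comet.

(** * Energy and level crossings *)

Section Telescope.
Local Open Scope ring_scope.
Variables (R : realType) (a : nat -> R).

Definition gap (l : nat) : R := a l.+1 - a l.

(* The square of a telescoping sum of gaps, without the products of gaps that
   are not adjacent. *)
Definition gap_form (i j : nat) : R :=
  \sum_(i <= l < j) gap l ^+ 2 + 2 * \sum_(i <= l < j.-1) gap l * gap l.+1.

Lemma gap_form_recr i j : (i <= j)%N ->
  gap_form i j.+2 = gap_form i j.+1 + gap j.+1 ^+ 2 + 2 * (gap j * gap j.+1).
Proof.
move=> ij; rewrite /gap_form /= [in LHS]big_nat_recr ?(leqW ij) //=.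
by rewrite [X in _ + 2 * X = _]big_nat_recr //=; ring.
Qed.

(** Adding one more gap to the square creates its products with all earlier gaps; those with gaps
    that are not adjacent are nonnegative and are dropped. *)
Lemma gap_form_le i j : (i <= j)%N ->
    (forall k l, (i <= k <= l)%N -> (l <= j)%N -> a k <= a l) ->
  gap_form i j <= (a j - a i) ^+ 2.
Proof.
move=> ij; rewrite -(subnKC ij); elim: (j - i)%N => {j ij} [|d IHd] mono.
  by rewrite /gap_form addn0 !big_geq ?leq_pred // mulr0 addr0 subrr expr0n.
have /IHd le : forall k l, (i <= k <= l)%N -> (l <= i + d)%N -> a k <= a l.
  by move=> k l kl ld; apply: mono => //; lia.
case: d mono le {IHd} => [|d] mono le.
  by rewrite /gap_form addn1 big_nat1 big_geq // mulr0 addr0.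
rewrite !addnS gap_form_recr ?leq_addr //.
have m1 : 0 <= gap (i + d).+1 by rewrite subr_ge0; apply: mono; lia.
have m2 : 0 <= a (i + d)%N - a i by rewrite subr_ge0; apply: mono; lia.
rewrite addnS in le.
have -> : (a (i + d).+2 - a i) ^+ 2 = (a (i + d).+1 - a i) ^+ 2 +
    gap (i + d).+1 ^+ 2 + 2 * (gap (i + d)%N * gap (i + d).+1) +
    2 * (gap (i + d).+1 * (a (i + d)%N - a i)).
  by rewrite /gap; ring.
by rewrite -[leLHS]addr0 lerD ?lerD // mulr_ge0 // mulr_ge0.
Qed.

(** From three gaps on, a positive product of gaps that are not adjacent has been dropped. *)
Lemma gap_form_lt i j : (i + 3 <= j)%N ->
    (forall k l, (i <= k < l)%N -> (l <= j)%N -> a k < a l) ->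
  gap_form i j < (a j - a i) ^+ 2.
Proof.
case: j => [|[|j]] ij mono; try lia.
rewrite gap_form_recr; last by lia.
have le : gap_form i j.+1 <= (a j.+1 - a i) ^+ 2.
  apply: gap_form_le => [|k l kl lj]; first by lia.
  have [->|kl'] := eqVneq k l; first by rewrite lexx.
  by apply/ltW/mono; lia.
have m1 : 0 < gap j.+1 by rewrite subr_gt0; apply: mono; lia.
have m2 : 0 < a j - a i by rewrite subr_gt0; apply: mono; lia.
have -> : (a j.+2 - a i) ^+ 2 = (a j.+1 - a i) ^+ 2 +
    gap j.+1 ^+ 2 + 2 * (gap j * gap j.+1) + 2 * (gap j.+1 * (a j - a i)).
  by rewrite /gap; ring.
by rewrite -[ltLHS]addr0 ler_ltD ?mulr_gt0 // !lerD.
Qed.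

Lemma big_nat_restrict (F : nat -> R) m n K : (n <= K)%N ->
  \sum_(m <= l < n) F l = \sum_(l < K) (if (m <= l < n)%N then F l else 0).
Proof.
move=> nK; rewrite -big_mkcond /= (big_nat_widenl m 0) // (big_nat_widen 0 n K) //.
by rewrite big_mkord.
Qed.

End Telescope.

Lemma ler_sum_eq (R : realType) (I : finType) (P : pred I) (F E : I -> R) :
  (forall i, P i -> F i <= E i)%R -> (\sum_(i | P i) E i <= \sum_(i | P i) F i)%R ->
  forall i, P i -> F i = E i.
Proof.
move=> le ge i Pi; apply/eqP; rewrite eq_sym -subr_eq0.
have /psumr_eq0P/(_ _ _ Pi) -> // : forall i, P i -> (0 <= E i - F i)%R.
  by move=> j /le; rewrite subr_ge0.
apply/le_anti; rewrite sumrB subr_le0 ge /= subr_ge0; exact: ler_sum.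
Qed.

(* [v 1], ..., [v K.+2] are the vertices in increasing order of value, [lev] is
   the position in this list, and all other vertices (leaves) have level 0. *)
Section Level.
Variables (G : sgraph) (K : nat) (lev : G -> nat) (v : nat -> G).
Hypotheses (trG : is_tree G) (G3 : 2 < #|G|).
Hypotheses (lev_le : forall x, lev x <= K.+2).
Hypotheses (levK : forall x, 0 < lev x -> v (lev x) = x).
Hypotheses (vK : forall j, 0 < j <= K.+2 -> lev (v j) = j).
Hypotheses (inner_lev : forall x, x \in inner G -> 0 < lev x).
Implicit Types (x y : G) (l : nat).

Definition up_edges : {set G * G} := [set p | adj p.1 p.2 && (lev p.1 < lev p.2)].
(** The edges over the gap [l], and below in [cross2] those over both gaps [l] and [l.+1]: they
    count how often [gap a l ^+ 2] and [gap a l * gap a l.+1] occur in the sum of the [gap_form]s of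
    all edges. *)
Definition cross1 l : {set G * G} := [set p in up_edges | lev p.1 <= l < lev p.2].
Definition cross2 l : {set G * G} := [set p in up_edges | lev p.1 <= l < (lev p.2).-1].

(** Leave the set of levels above [l.+1] while avoiding [v l.+1], the only vertex of level [l.+1]:
    the edge must end at level [l] or lower. *)
Lemma cross2_exists l : l < K.+1 -> (forall x, l.+1 < lev x -> x \in inner G) ->
  0 < #|cross2 l|.
Proof.
move=> lK upper; pose S := [set x | l.+1 < lev x].
have [|||s [w [sS wS wv sw]]] := @exit_edge _ (tree_acyclic trG) S (v l.+1) (v K.+2).
- by rewrite inE vK //; lia.
- by rewrite inE vK ?ltnn //; lia.
- by move=> s; rewrite inE => /upper; apply: inner_degree => //; exact: ltnW.
rewrite !inE -leqNgt in sS wS.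
have lw : lev w <= l.
  rewrite -ltnS ltn_neqAle wS andbT; apply: contraNneq wv => e.
  by rewrite -e levK // e.
by apply/card_gt0P; exists (w, s); rewrite !inE /= adjC sw; lia.
Qed.

(** Leave the upper set once, then once more while avoiding the end of the first edge. *)
Lemma cross1_gt1 l : l < K.+2 -> (forall x, l < lev x -> x \in inner G) ->
  1 < #|cross1 l|.
Proof.
move=> lK upper; pose S := [set x | l < lev x].
have [r rl] : exists r, r \in leaves G by apply/card_gt0P/ltnW/leaves_gt1/ltnW.
have exitP u : u \notin S -> exists s w, [/\ s \in S, w \notin S, w != u & adj s w].
  move=> uS; apply: (exit_edge (tree_acyclic trG) (x := v K.+2)) => //.
    by rewrite inE vK //; lia.
  by move=> s; rewrite inE => /upper; apply: inner_degree => //; exact: ltnW.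
have rS : r \notin S by rewrite inE; apply: contraL rl => /upper; rewrite in_inner.
have [s [w [sS wS _ sw]]] := exitP _ rS; have [s' [w' [sS' wS' ww' sw']]] := exitP _ wS.
apply/card_gt1P; exists (w', s'), (w, s); rewrite !inE -?leqNgt in sS wS sS' wS' *.
split; rewrite /= 1?adjC ?sw ?sw'; try lia.
by rewrite xpair_eqE negb_and ww'.
Qed.

(** Every leaf then has level 0 and its edge leads to an inner vertex, hence to a positive level. *)
Lemma cross1_0_ge : (forall x, 0 < lev x -> x \in inner G) -> #|leaves G| <= #|cross1 0|.
Proof.
move=> upper; pose h x := (x, odflt x [pick y | adj x y]).
have <- : #|h @: leaves G| = #|leaves G| by apply: card_imset => x y [].
apply/subset_leq_card/fintype.subsetP => _ /imsetP[x xl ->].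
have [y ey] := leaf_nbr xl; rewrite /h; case: pickP => [z xz|/(_ y)];
  last by rewrite ey eqxx.
have lx : lev x = 0 by apply/eqP; rewrite -leqn0 leqNgt; apply: contraL xl => /upper;
  rewrite in_inner.
by rewrite !inE /= lx xz leqnn !(inner_lev (leaf_nbr_inner trG G3 xl xz)).
Qed.

Local Open Scope ring_scope.
Variables (R : realType) (a : nat -> R) (b : nat).
Hypotheses (a0 : a 0 = 0).
Hypotheses (a_mono : forall i j, (i <= j <= K.+2)%N -> a i <= a j).

Definition cut_size (l : nat) : nat := if l is 0 then b else 2.

(* The energy of the comet, see [zigzag_energy]. *)
Definition level_form : R := b%:R * gap a 0 ^+ 2 +
  2 * \sum_(1 <= l < K.+2) gap a l ^+ 2 + 2 * \sum_(l < K.+1) gap a l * gap a l.+1.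

Definition count_form : R := \sum_(l < K.+2) #|cross1 l|%:R * gap a l ^+ 2 +
  2 * \sum_(l < K.+1) #|cross2 l|%:R * (gap a l * gap a l.+1).

Definition up_energy : R := \sum_(p in up_edges) (a (lev p.2) - a (lev p.1)) ^+ 2.

Lemma energy2_up : energy2 (a \o lev) (a \o lev) = 2 * up_energy.
Proof.
rewrite /energy2 pair_big_dep /= (bigID (mem up_edges)) /= mulr_natl mulr2n.
congr (_ + _).
  apply: eq_big => [[x y]|[x y] _]; first by rewrite /up_edges !inE /= andbA andbb.
  by rewrite /= -expr2 -sqrrN opprB.
rewrite (bigID (fun p => lev p.1 == lev p.2)) /= big1 ?add0r => [|[x y] /andP[_ /eqP
  e]]; last first.
  by rewrite /= e subrr mul0r.
rewrite (reindex (fun p : G * G => (p.2, p.1))) /=;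
  last by exists (fun p => (p.2, p.1)) => -[].
apply: eq_big => [[x y]|[x y] _]; rewrite ?inE /=; last by rewrite -expr2.
by rewrite adjC; case: adj => //=; rewrite -leqNgt ltn_neqAle andbC eq_sym.
Qed.

(** Double counting of pairs of an edge and a gap; the summation ranges are first made independent
    of the edge. *)
Lemma count_formE : count_form = \sum_(p in up_edges) gap_form a (lev p.1) (lev p.2).
Proof.
rewrite /gap_form big_split /= -mulr_sumr; congr (_ + 2 * _).
  under [RHS]eq_bigr => p _ do rewrite (big_nat_restrict _ _ (lev_le p.2)).
  rewrite exchange_big /=; apply: eq_bigr => l _.
  rewrite -big_mkcondr /= mulr_natl -sumr_const; apply: eq_bigl => p.
  by rewrite inE.
under [RHS]eq_bigr => p _.
  rewrite (@big_nat_restrict _ _ _ _ K.+1); last by have := lev_le p.2; lia.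
over.
rewrite exchange_big /=; apply: eq_bigr => l _.
rewrite -big_mkcondr /= mulr_natl -sumr_const; apply: eq_bigl => p.
by rewrite inE.
Qed.

Lemma gap_ge0 l : (l < K.+2)%N -> 0 <= gap a l.
Proof. by move=> lK; rewrite subr_ge0 a_mono // leqnSn. Qed.

Lemma count_form_le : count_form <= up_energy.
Proof.
rewrite count_formE; apply: ler_sum => p; rewrite inE => /andP[_ lt].
apply: gap_form_le => [|k l kl lp]; first exact: ltnW.
by apply: a_mono; have := lev_le p.2; lia.
Qed.

Hypothesis (leaf0 : forall x, x \in leaves G -> a (lev x) = 0).
Hypothesis (leaves_b : (forall x, (0 < lev x)%N -> x \in inner G) -> (b <= #|leaves G|)%N).

(** The crossing bounds need the upper levels to be interior. Where a leaf lies above the gap,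
    monotonicity squeezes all values below it to 0, and the gap contributes nothing. *)
Lemma gap0_or_inner l : (l < K.+2)%N ->
  gap a l = 0 \/ (forall x, (l < lev x)%N -> x \in inner G).
Proof.
move=> lK; have [/existsP[x /andP[lx xl]]|no] := boolP [exists x, (l < lev x)%N && (x
  \in leaves G)].
  left; apply/le_anti; rewrite gap_ge0 // andbT subr_le0.
  have := a_mono (i := l.+1) (j := lev x); rewrite lx lev_le leaf0 // => /(_ isT) le.
  by apply: le_trans le _; rewrite -a0 a_mono //= ltnW.
right=> x lx; rewrite in_inner; apply: contraNN no => xl.
by apply/existsP; exists x; rewrite lx.
Qed.

Lemma cross1_term_le l : (l < K.+2)%N ->
  (cut_size l)%:R * gap a l ^+ 2 <= #|cross1 l|%:R * gap a l ^+ 2.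
Proof.
move=> lK; have [->|upper] := gap0_or_inner lK; first by rewrite expr0n /= !mulr0.
rewrite ler_wpM2r ?sqr_ge0 // ler_nat; case: l lK upper => [|l] lK upper.
  exact: leq_trans (leaves_b upper) (cross1_0_ge upper).
exact: cross1_gt1.
Qed.

Lemma cross2_term_le l : (l < K.+1)%N ->
  gap a l * gap a l.+1 <= #|cross2 l|%:R * (gap a l * gap a l.+1).
Proof.
move=> lK; have [->|upper] := @gap0_or_inner l.+1 lK; first by rewrite !mulr0.
rewrite ler_peMl ?mulr_ge0 ?gap_ge0 //; first exact: leqW.
by rewrite ler1n; exact: cross2_exists.
Qed.

Lemma level_formE : level_form =
  \sum_(l < K.+2) (cut_size l)%:R * gap a l ^+ 2 +
  2 * \sum_(l < K.+1) gap a l * gap a l.+1.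
Proof.
rewrite /level_form; congr (_ + _); rewrite big_ord_recl /=; congr (_ + _).
by rewrite mulr_sumr big_add1 /= big_mkord.
Qed.

Lemma level_form_le_count : level_form <= count_form.
Proof.
rewrite level_formE lerD //; first by apply: ler_sum => l _; exact: cross1_term_le.
by rewrite ler_pM2l //; apply: ler_sum => l _; exact: cross2_term_le.
Qed.

Lemma level_form_le_energy2 : 2 * level_form <= energy2 (a \o lev) (a \o lev).
Proof.
by rewrite energy2_up ler_pM2l //; exact: le_trans level_form_le_count count_form_le.
Qed.

(** The chain [level_form <= count_form <= up_energy] collapses, so its termwise inequalities are
    equalities, and the positive gaps can be cancelled. *)
Lemma energy2_le_level_form :
    energy2 (a \o lev) (a \o lev) <= 2 * level_form ->
    (forall l, (l < K.+2)%N -> 0 < gap a l) ->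
  [/\ forall x y, adj x y -> (lev x < lev y)%N -> (lev y <= lev x + 2)%N,
      forall l, (0 < l < K.+2)%N -> #|cross1 l| = 2
    & forall l, (l < K.+1)%N -> #|cross2 l| = 1].
Proof.
rewrite energy2_up ler_pM2l // => ge gap_gt0.
have a_smono i j : (i < j <= K.+2)%N -> a i < a j.
  case/andP=> ij jK; apply: (@lt_le_trans _ _ (a i.+1)); last by apply: a_mono; lia.
  by rewrite -subr_gt0 gap_gt0 // (leq_trans ij).
have ec : count_form = up_energy.
  by apply/le_anti; rewrite count_form_le (le_trans ge level_form_le_count).
have el : level_form = count_form.
  by apply/le_anti; rewrite level_form_le_count (le_trans count_form_le ge).
split=> [x y xy lxy|l /andP[l0 lK]|l lK].
- rewrite leqNgt; apply/negP => lt.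
  have := @ler_sum_eq _ _ (mem up_edges) (fun p => gap_form a (lev p.1) (lev p.2))
    (fun p => (a (lev p.2) - a (lev p.1)) ^+ 2) _ _ (x, y).
  rewrite /= inE /= xy lxy => e.
  have /eqP : gap_form a (lev x) (lev y) = (a (lev y) - a (lev x)) ^+ 2.
    apply: e => //; last by rewrite -count_formE ec.
    move=> p; rewrite inE => /andP[_ lt'].
    apply: gap_form_le => [|k l kl lp]; first exact: ltnW.
    by apply: a_mono; have := lev_le p.2; lia.
  apply/negP; rewrite lt_eqF //; apply: gap_form_lt => [|k l kl ly]; first by lia.
  by apply: a_smono; have := lev_le y; lia.
- have e := @ler_sum_eq _ _ predT
    (fun l : 'I_K.+2 => (cut_size l)%:R * gap a l ^+ 2)
    (fun l : 'I_K.+2 => #|cross1 l|%:R * gap a l ^+ 2).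
  have := e _ _ (Ordinal lK) isT; rewrite /=.
  case: l l0 lK => // l _ lK h; apply/eqP; rewrite -(eqr_nat R).
  have g2 : gap a l.+1 ^+ 2 != 0 by rewrite sqrf_eq0 gt_eqF ?gap_gt0.
  apply/eqP/esym/(mulIf g2); apply: h => [i _|]; first exact: cross1_term_le.
  (* The totals agree and the second sums compare in the same direction, so the first sums agree as
     well. *)
  have := el; rewrite level_formE /count_form => el'.
  have : \sum_(l < K.+1) gap a l * gap a l.+1 <=
     \sum_(l < K.+1) #|cross2 l|%:R * (gap a l * gap a l.+1).
    by apply: ler_sum => j _; exact: cross2_term_le.
  lra.
have e := @ler_sum_eq _ _ predT
    (fun l : 'I_K.+1 => gap a l * gap a l.+1)
    (fun l : 'I_K.+1 => #|cross2 l|%:R * (gap a l * gap a l.+1)).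
have := e _ _ (Ordinal lK) isT; rewrite /= => h.
apply/eqP; rewrite -(eqr_nat R).
have g2 : gap a l * gap a l.+1 != 0.
  by rewrite mulf_neq0 // gt_eqF ?gap_gt0 //; exact: leqW.
apply/eqP/esym/(mulIf g2); rewrite mul1r; apply: h => [i _|]; first exact: cross2_term_le.
have := el; rewrite level_formE /count_form => el'.
have : \sum_(l < K.+2) (cut_size l)%:R * gap a l ^+ 2 <=
   \sum_(l < K.+2) #|cross1 l|%:R * gap a l ^+ 2.
  by apply: ler_sum => j _; exact: cross1_term_le.
lra.
Qed.

End Level.

(** * Energy and Laplacian of the comet *)

Section ZigzagEnergy.
Variables p b : nat.
(** The neighbor of [inl k] towards the middle of the path; the two middle vertices [p] and [p + 1]
    point at each other. *)
Definition zigzag_up (k : nat) : nat := if k < p then k + 2 else 2 * p + 1 - k.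

Lemma zigzag_up_ub k : k < p + 2 -> zigzag_up k < p + 2.
Proof. by rewrite /zigzag_up; case: ifP; lia. Qed.

Hypothesis b2 : 2 <= b.
Let Z := zigzag p b.

Lemma zigzag_leaves (x : Z) : (x \in leaves Z) = if x is inr _ then true else false.
Proof.
case: x => [k|j]; rewrite inE; last first.
  have lt : (j == 0 :> nat) < p + 2 by case: eqP; lia.
  apply/cards1P; exists (inl (Ordinal lt)); apply/finset.setP => -[i|i]; rewrite !inE //=.
apply/negbTE; rewrite neq_ltn; apply/orP; right.
have lt0 : 0 < b by exact: ltnW.
have adj_up : adj (inl k : Z) (inl (Ordinal (zigzag_up_ub (ltn_ord k)))).
  by rewrite /= /zigzag_up; have := ltn_ord k; case: ifP; lia.
have [k0|k0] := eqVneq (k : nat) 0.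
  by apply: (@degree_gt1 Z _ _ (inr (Ordinal b2)) adj_up); rewrite //= k0.
have [k1|k1] := eqVneq (k : nat) 1.
  by apply: (@degree_gt1 Z _ _ (inr (Ordinal lt0)) adj_up); rewrite //= k1.
have lt : k - 2 < p + 2 by have := ltn_ord k; lia.
apply: (@degree_gt1 Z _ _ (inl (Ordinal lt)) adj_up).
  by rewrite /=; lia.
by apply/eqP => -[]; rewrite /zigzag_up; have := ltn_ord k; case: ifP; lia.
Qed.

Local Open Scope ring_scope.
Variables (R : realType) (a : nat -> R).
Hypothesis a0 : a 0 = 0.

Definition zigzag_level (x : Z) : nat := if x is inl k then k.+1 else 0%N.

Definition zigzag_fun : {ffun Z -> R} := [ffun x => a (zigzag_level x)].

Lemma zigzag_fun_dirichlet : dirichlet zigzag_fun.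
Proof. by move=> x; rewrite zigzag_leaves ffunE; case: x => //= j _. Qed.

Let sum_addn2 (F : nat -> R) : \sum_(l < p.+2) F l = \sum_(l < p + 2) F l.
Proof. by rewrite addn2. Qed.

Lemma zigzag_sqnorm : sqnorm zigzag_fun = \sum_(l < p.+2) a l.+1 ^+ 2.
Proof.
rewrite /sqnorm big_sumType /= [X in _ + X]big1 ?addr0 => [|j _].
  by rewrite (sum_addn2 (fun l => a l.+1 ^+ 2)); apply: eq_bigr => k _; rewrite ffunE.
by rewrite ffunE /= a0 expr0n.
Qed.

(** The value of [inl k] is [a k.+1], so that of its outer neighbor [inl (k - 2)] is [a k.-1]. For
    [k = 1] this is [a 0 = 0], the value at pendant 0. *)
Definition zigzag_flux (k : nat) : R :=
  (a k.+1 - a (zigzag_up k).+1) +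
  (if k is 0%N then b.-1%:R * a 1 else a k.+1 - a k.-1).

Lemma zigzag_laplacian (k : 'I_(p + 2)) :
  - laplacian zigzag_fun (inl k) = zigzag_flux k.
Proof.
rewrite /laplacian big_sumType /= opprD.
have -> : - (\sum_(i < p + 2 | [|| i == (k + 2)%N :> nat, k == (i + 2)%N :> nat
      | (k + i)%N == (2 * p + 1)%N]) (zigzag_fun (inl i) - zigzag_fun (inl k))) =
    (a k.+1 - a (zigzag_up k).+1) + (if (2 <= k)%N then a k.+1 - a k.-1 else 0).
  rewrite -sumrN.
  (* The subtraction [k - 2] truncates to 0, so the test [2 <= k] removes the spurious neighbor. *)
  transitivity (\sum_(i < p + 2) ((if i == zigzag_up k :> nat then a k.+1 - a i.+1 else 0) +
     (if i == (k - 2)%N :> nat then if (2 <= k)%N then a k.+1 - a i.+1 else 0 else 0))).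
    rewrite big_mkcond; apply: eq_bigr => i _; rewrite !ffunE opprB.
    have ltk := ltn_ord k; have lti := ltn_ord i; rewrite /zigzag_up.
    do ?[case: ifP]; rewrite ?addr0 ?add0r //; lia.
  rewrite big_split /= -!big_mkcond /=.
  rewrite (@big_ord1_eq _ _ _ (fun i => a k.+1 - a i.+1)) zigzag_up_ub //.
  rewrite (@big_ord1_eq _ _ _ (fun i => if (2 <= k)%N then a k.+1 - a i.+1 else 0)).
  have -> : (k - 2 < p + 2)%N by have := ltn_ord k; lia.
  by congr (_ + _); case: leqP => // k2; congr (_ - a _); lia.
have -> : - (\sum_(j < b | k == (j == 0%N :> nat) :> nat) (zigzag_fun (inr j) -
  zigzag_fun (inl k)))
    = #|[pred j : 'I_b | k == (j == 0%N :> nat) :> nat]|%:R * a k.+1.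
  rewrite -sumrN mulr_natl -sumr_const; apply: eq_big => // j _.
  by rewrite !ffunE /= a0 opprB subr0.
rewrite -addrA; congr (_ + _).
have b0 : (0 < b)%N by exact: ltnW.
have c0 : #|[pred j : 'I_b | j == 0%N :> nat]| = 1%N.
  by rewrite -(card1 (Ordinal b0)); apply: eq_card => j; rewrite !inE.
case: (k : nat) => [|[|k']] /=.
- rewrite add0r; congr (_%:R * _).
  have := cardC [pred j : 'I_b | j == 0%N :> nat]; rewrite c0 card_ord => cb.
  rewrite (_ : b.-1 = #|[predC [pred j : 'I_b | j == 0%N :> nat]]|);
    last exact: (congr1 predn (esym cb)).
  by apply: eq_card => j; rewrite !inE; case: (nat_of_ord j).
- rewrite add0r a0 subr0 (_ : #|_| = 1%N) ?mul1r // -[RHS]c0.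
  by apply: eq_card => j; rewrite !inE; case: (nat_of_ord j).
rewrite (_ : #|_| = 0%N) ?mul0r ?addr0 //; apply: eq_card0 => j.
by rewrite !inE; case: (nat_of_ord j).
Qed.

(** Green's formula reduces the energy to the fluxes. The inward term of [inl i] and the outward
    term of [inl (i + 2)] combine to the square of two consecutive gaps, whose expansion gives the
    products of [level_form]. *)
Lemma zigzag_energy : energy2 zigzag_fun zigzag_fun = 2 * level_form p a b.
Proof.
rewrite energy2E; congr (_ * _); rewrite big_sumType /= [X in _ + X]big1 ?addr0; last first.
  by move=> j _; rewrite ffunE /= a0 mul0r.
transitivity (\sum_(l < p.+2) a l.+1 * zigzag_flux l).
  rewrite (sum_addn2 (fun l => a l.+1 * zigzag_flux l)).
  by apply: eq_bigr => k _; rewrite ffunE zigzag_laplacian.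
transitivity (\sum_(l < p.+2) a l.+1 * (a l.+1 - a (zigzag_up l).+1) +
   (b.-1%:R * a 1 ^+ 2 + a 2 ^+ 2 + \sum_(l < p) a l.+3 * (a l.+3 - a l.+1))).
  under eq_bigr do rewrite mulrDr; rewrite big_split /=; congr (_ + _).
  rewrite !big_ord_recl /= -addrA; congr (_ + _); first by ring.
  by rewrite a0 subr0 -expr2.
rewrite !big_ord_recr /= /level_form.
have -> : zigzag_up p = p.+1 by rewrite /zigzag_up; case: ifP; lia.
have -> : zigzag_up p.+1 = p by rewrite /zigzag_up; case: ifP; lia.
have -> : \sum_(i < p) a i.+1 * (a i.+1 - a (zigzag_up i).+1) =
    \sum_(i < p) a i.+1 * (a i.+1 - a i.+3).
  by apply: eq_bigr => i _; rewrite /zigzag_up ltn_ord addn2.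
have -> : \sum_(i < p) a i.+1 * (a i.+1 - a i.+3) =
  \sum_(i < p) (gap a i.+1 + gap a i.+2) ^+ 2
    - \sum_(l < p) a l.+3 * (a l.+3 - a l.+1).
  by rewrite -sumrB; apply: eq_bigr => i _; rewrite /gap; ring.
have -> : \sum_(i < p) (gap a i.+1 + gap a i.+2) ^+ 2 = \sum_(i < p) gap a i.+1 ^+ 2
    + \sum_(i < p) gap a i.+2 ^+ 2 + 2 * \sum_(i < p) gap a i.+1 * gap a i.+2.
  rewrite mulr_sumr -!big_split /=; apply: eq_bigr => i _; ring.
have -> : \sum_(1 <= l < p.+2) gap a l ^+ 2 = \sum_(i < p.+1) gap a i.+1 ^+ 2.
  by rewrite big_add1 big_mkord.
have e1 : \sum_(i < p.+1) gap a i.+1 ^+ 2 = gap a 1 ^+ 2 + \sum_(i < p) gap a i.+2 ^+ 2.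
  by rewrite big_ord_recl.
have e2 : \sum_(i < p.+1) gap a i.+1 ^+ 2 = \sum_(i < p) gap a i.+1 ^+ 2 + gap a p.+1 ^+ 2.
  by rewrite big_ord_recr.
have -> : \sum_(l < p.+1) gap a l * gap a l.+1 =
  gap a 0 * gap a 1 + \sum_(i < p) gap a i.+1 * gap a i.+2.
  by rewrite big_ord_recl.
have -> : b%:R = b.-1%:R + 1 :> R by rewrite natr1 prednK // ltnW.
have g0 : gap a 0 = a 1 by rewrite /gap a0 subr0.
have g1 : gap a 1 = a 2 - a 1 by [].
have gp : gap a p.+1 = a p.+2 - a p.+1 by [].
have -> : 2 * \sum_(i < p.+1) gap a i.+1 ^+ 2 = gap a 1 ^+ 2 + \sum_(i < p) gap a i.+2 ^+ 2
    + (\sum_(i < p) gap a i.+1 ^+ 2 + gap a p.+1 ^+ 2).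
  by rewrite mulr_natl mulr2n {1}e1 e2.
rewrite g0 g1 gp.
ring.
Qed.

End ZigzagEnergy.

(** * Monotone eigenfunctions of the comet *)

Section ZigzagEigenfunction.
Local Open Scope ring_scope.
Variables (p b : nat) (R : realType) (a : nat -> R) (l : R).
Hypothesis a0 : a 0 = 0.
Hypothesis a_mono : forall i j, (i <= j <= p.+2)%N -> a i <= a j.
Hypothesis eigen : forall k, (k < p.+2)%N -> zigzag_flux p b a k = l * a k.+1.

(** Where a nonnegative eigenfunction vanishes, its neighbors vanish too; the inner neighbor of
    [inl j] has at least the value [a j.+2]. *)
Lemma zigzag_eigenfunction0 : a 1 = 0 -> forall j, (j <= p.+2)%N -> a j = 0.
Proof.
move=> a1; elim=> [//|[//|j]] IHj jp; have aj := IHj (ltnW jp).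
have ge0 i : (i <= p.+2)%N -> 0 <= a i by move=> ip; rewrite -a0 a_mono.
have lt : (j < p.+2)%N by lia.
have := eigen lt; rewrite /zigzag_flux aj mulr0.
have upb : (zigzag_up p j < p + 2)%N by apply: zigzag_up_ub; lia.
have up0 : 0 <= a (zigzag_up p j).+1 by apply: ge0; lia.
have le : a j.+2 <= a (zigzag_up p j).+1.
  apply: a_mono; move: upb; rewrite /zigzag_up; case: ifP; lia.
have := ge0 j.+2 jp.
case: j {IHj} lt jp aj upb up0 le => [|j] lt jp aj upb up0 le; first by rewrite a1; lra.
have : 0 <= a j by apply: ge0; lia.
rewrite /=; lra.
Qed.

(** At a first tie, two consecutive vertices have equal value and hence equal flux. The inward
    neighbors are ordered by [up_le], so the outer ones would have to compensate, against the
    previous positive gap or, at the first two vertices, against [b > 2]. *)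
Lemma zigzag_eigenfunction_gap : (2 < b)%N -> 0 < a 1 ->
  forall j, (j < p.+2)%N -> 0 < gap a j.
Proof.
move=> b3 a1; elim/ltn_ind => -[|j] IHj jp; first by rewrite /gap a0 subr0.
have ge : 0 <= gap a j.+1 by rewrite subr_ge0 a_mono // leqnSn.
rewrite lt_def ge andbT subr_eq0; apply/eqP => tie.
have up_le : a (zigzag_up p j).+1 <= a (zigzag_up p j.+1).+1.
  have [ltj|] := ltnP j.+1 p.
    by rewrite /zigzag_up ltj (ltnW ltj); apply: a_mono; lia.
  rewrite leq_eqVlt => /orP[/eqP ej|ltj].
    by rewrite (_ : zigzag_up p j = zigzag_up p j.+1) // /zigzag_up; do ?[case: ifP]; lia.
  have -> : zigzag_up p j = j.+1 by rewrite /zigzag_up; case: ifP; lia.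
  have -> : zigzag_up p j.+1 = j by rewrite /zigzag_up; case: ifP; lia.
  by rewrite tie.
have := eigen jp; have := eigen (ltnW jp); rewrite /zigzag_flux tie /=.
case: j IHj jp ge tie up_le => [|j] IHj jp ge tie up_le /=.
  rewrite a0 subr0.
  have : 2 * a 1 <= b.-1%:R * a 1 by rewrite ler_pM2r // (ler_nat _ 2); lia.
  lra.
have : 0 < gap a j by apply: IHj; lia.
rewrite /gap; lra.
Qed.

End ZigzagEigenfunction.

(** * The equality case *)

(* With two leaves the comet is a path: its symmetric first eigenfunction takes
   equal values, so the positions of the vertices cannot be read off from their levels. *)
Section PathCase.
Variables (G : sgraph) (p : nat).
Hypotheses (trG : is_tree G) (cG : #|G| = p + 4) (leaves2 : #|leaves G| = 2).

(** The degree sum is at most [2 * #|G| - 2]; the two leaves contribute 2 and every other vertex at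
    least 2, so there is no room for a larger degree. *)
Lemma two_leaves_degree_le (x : G) : degree x <= 2.
Proof.
have G1 : 1 < #|G| by rewrite cG; lia.
have := sum_nbrs_le (tree_acyclic trG) (X := [set: G]); rewrite cardsT => /(_ _).
have -> : \sum_(x in [set: G]) #|nbrs [set: G] x| = \sum_(x : G) degree x.
  by apply: eq_big => [y|y _]; rewrite ?inE ?nbrsT.
have XT : [set: G] != finset.set0 by apply/set0Pn; exists x; rewrite inE.
move=> /(_ XT); rewrite (bigID (mem (leaves G))) /=.
rewrite (eq_bigr (fun=> 1)) => [|y /leavesP//]; rewrite sum1_card leaves2.
have [xl|xl] := boolP (x \in leaves G); first by rewrite (leavesP _ xl).
rewrite (bigD1 x) //= => le; have : \sum_(i | (i \notin leaves G) && (i != x)) 2 <=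
    \sum_(i | (i \notin leaves G) && (i != x)) degree i.
  by apply: leq_sum => i /andP[il _]; apply: inner_degree; rewrite ?in_inner.
rewrite sum_nat_const; have : #|[pred i | (i \notin leaves G) && (i != x)]| = p.+1.
  have := cardsD1 x (inner G); rewrite card_inner // leaves2 cG in_inner xl.
  rewrite (_ : #|inner G :\ x| = #|[pred i | (i \notin leaves G) && (i != x)]|);
    first by lia.
  by apply: eq_card => i; rewrite !inE andbC.
by rewrite cG in le *; move=> ->; lia.
Qed.

Lemma two_leaves_isomorphic : isomorphic G (Tpqb p 2 2).
Proof.
have [r rl] : exists r, r \in leaves G by apply/card_gt0P; rewrite leaves2.
have [w ew] := leaf_nbr rl.
have rw : adj r w by rewrite ew.
have [|||y [q [yq uyq _ [szq lq] ny]]] := @path_to_end _ (tree_acyclic trG) [set: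
  G] w [:: r].
- by rewrite /= adjC rw.
- by rewrite /= inE !andbT; apply: contraTneq rw => ->; rewrite adj_irrefl.
- by move=> x _; rewrite inE.
pose N := size (y :: q); pose c i := nth y (y :: q) i.
have cinj i j : i < N -> j < N -> c i = c j -> i = j.
  by move=> iN jN /eqP; rewrite nth_uniq // => /eqP.
have cadj i : i.+1 < N -> adj (c i) (c i.+1).
  by move=> iN; have /(pathP y)/(_ i) := yq; apply.
(* The path cannot be left: at its ends by construction, in between by the degree bound. By
   connectedness it is then all of [G]. *)
have cnbr i z : i < N -> adj (c i) z -> (0 < i /\ z = c i.-1) \/ (i.+1 < N /\ z = c i.+1).
  move=> iN iz.
  have [i0|i0] := posnP i.
    right; split; first by rewrite i0.
    have le1 : #|nbrs [set: G] (c i)| <= 1 by rewrite i0.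
    move/card_le1_eqP: le1; apply; rewrite in_nbrs inE //=.
    by apply: cadj; rewrite i0.
  have adjp : adj (c i) (c i.-1) by rewrite adjC -{2}(prednK i0); apply: cadj;
    rewrite prednK.
  have [iN1|iN1] := eqVneq i.+1 N.
    left; split => //; have cr : c i = r.
      by rewrite -[r]/(last w [:: r]) -lq /c (last_nth y) -[size q]/(N.-1) -iN1.
    move: iz adjp; rewrite cr !ew => /eqP-> /eqP->//.
  have iN2 : i.+1 < N by rewrite ltn_neqAle iN1.
  have [->|zp] := eqVneq z (c i.-1); first by left.
  have [->|zn] := eqVneq z (c i.+1); first by right.
  have : 2 < degree (c i); last by have := two_leaves_degree_le (c i); lia.
  have pn : c i.-1 != c i.+1 by apply/eqP => /cinj; lia.
  rewrite (_ : 3 = #|[set z; c i.-1; c i.+1]|).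
    apply/subset_leq_card/fintype.subsetP => u; rewrite !inE => /orP[/orP[]|] /eqP-> //.
    exact: cadj.
  by rewrite -finset.setUA cardsU1 cards2 pn !inE negb_or zp zn.
have all_c z : exists2 i, i < N & z = c i.
  have /finset.setP/(_ z) : [set x in y :: q] = [set: G].
    apply: (closed_setT trG (x := y)); first by rewrite !inE eqxx.
    move=> u u'; rewrite finset.in_set => /(nthP y)[i iN <-] /(cnbr _ _ iN) h.
    by case: h => -[lti ->]; rewrite finset.in_set mem_nth //; lia.
  by rewrite !finset.in_set => /(nthP y)[i iN <-]; exists i.
have NE : N = p + 4.
  rewrite -cG /N -(card_uniqP uyq); apply: eq_card => z; rewrite [RHS]inE.
  by have [i iN ->] := all_c z; rewrite mem_nth.
pose h (x : Tpqb p 2 2) : nat :=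
  match x with inl i => i.+1 | inr j => if j == 0 :> nat then 0 else p + 3 end.
have hN x : h x < N by rewrite NE; case: x => [i|j] /=; [have := ltn_ord i|case: ifP]; lia.
apply: isomorphic_sym; apply: (@inj_isomorphic _ _ (c \o h)).
- by rewrite cG card_comet; lia.
- move=> x1 x2 /= /cinj; rewrite !hN => /(_ isT isT).
  case: x1 x2 => [i|j] [i'|j'] /=; have := ltn_ord.
  + by move=> _ [e]; congr inl; exact: val_inj.
  + by move/(_ _ i); case: ifP; lia.
  + by move/(_ _ i'); case: ifP; lia.
  + move=> lt e; congr inr; apply: val_inj => /=.
    by move: e (lt _ j) (lt _ j'); do 2 case: eqP; lia.
have adjE i j : i < N -> j < N -> adj (c i) (c j) = (i.+1 == j) || (j.+1 == i).
  move=> iN jN; apply/idP/idP => [/(cnbr _ _ iN)|/orP[/eqP e|/eqP e]].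
  - by case=> -[lti /cinj]; lia.
  - by rewrite -e cadj // e.
  - by rewrite -e adjC cadj // e.
move=> x1 x2 /=; rewrite adjE ?hN //.
case: x1 x2 => [i|j] [i'|j'] //=; rewrite /pendant_base.
- by have := ltn_ord i; have := ltn_ord j'; do ?[case: ifP]; lia.
- by have := ltn_ord i'; have := ltn_ord j; do ?[case: ifP]; lia.
- by have := ltn_ord j'; have := ltn_ord j; do ?[case: ifP]; lia.
Qed.

End PathCase.

Section ZigzagCase.
Variables (G : sgraph) (p b : nat) (lev : G -> nat) (v : nat -> G).
Hypotheses (trG : is_tree G) (G3 : 2 < #|G|) (b2 : 2 <= b).
Hypotheses (lev_le : forall x, lev x <= p.+2).
Hypotheses (levK : forall x, 0 < lev x -> v (lev x) = x).
Hypotheses (vK : forall j, 0 < j <= p.+2 -> lev (v j) = j).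
Hypotheses (innerE : forall x, (x \in inner G) = (0 < lev x)).
Hypotheses (cG : #|G| = p + 2 + b) (cl : #|leaves G| = b).
Hypotheses (lev_adj : forall x y, adj x y -> lev x < lev y -> lev y <= lev x + 2).
Hypotheses (card_cross1 : forall l, 0 < l < p.+2 -> #|cross1 lev l| = 2).
Hypotheses (card_cross2 : forall l, l < p.+1 -> #|cross2 lev l| = 1).

Let in_cross2 l x y : adj x y -> lev x = l -> lev y = l + 2 -> (x, y) \in cross2 lev l.
Proof. by move=> xy ex ey; rewrite !inE /= xy ex ey; lia. Qed.

Let cross2_pair l : l < p.+1 -> exists x y, [/\ adj x y, lev x = l & lev y = l + 2].
Proof.
move=> lp; have /eqP/cards1P[[x y] e] := card_cross2 lp.
have : (x, y) \in cross2 lev l by rewrite e inE.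
rewrite !inE /= => /andP[/andP[xy lt] h]; exists x, y; have := lev_adj xy lt.
by split => //; lia.
Qed.

Let cross2_unique l x y x' y' : l < p.+1 ->
  adj x y -> lev x = l -> lev y = l + 2 ->
  adj x' y' -> lev x' = l -> lev y' = l + 2 -> x = x'.
Proof.
move=> lp xy ex ey xy' ex' ey'; have /eqP/cards1P[q e] := card_cross2 lp.
have := in_cross2 xy ex ey; have := in_cross2 xy' ex' ey'.
by rewrite e !inE => /eqP <- /eqP[-> _].
Qed.

Let adj_skip l : 0 < l < p.+1 -> adj (v l) (v l.+2).
Proof.
case/andP=> l0 lp; have [x [y [xy ex ey]]] := cross2_pair lp.
by rewrite -addn2 -{1}ex -ey !levK // ?ex ?ey //; lia.
Qed.

(** For [l <= p] the edges from level [l] to [l + 2] and from [l - 1] to [l + 1] already use up the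
    two crossings of gap [l]. Over the top gap only one edge skips a level, so the second crossing
    joins consecutive levels. *)
Let adj_consecutive l : 0 < l < p.+2 -> adj (v l) (v l.+1) = (l == p.+1).
Proof.
case/andP=> l0 lp.
have lv : lev (v l) = l by apply: vK; lia.
have lvS : lev (v l.+1) = l.+1 by apply: vK; lia.
apply/idP/eqP => [a|e].
  have [//|/eqP ne] := eqVneq l p.+1.
  have lp1 : l < p.+1 by lia.
  have [x [y [xy ex ey]]] := cross2_pair lp1.
  have [|x' [y' [xy' ex' ey']]] := @cross2_pair l.-1; first by lia.
  have : 2 < #|cross1 lev l|; last by rewrite card_cross1 ?l0.
  have ne1 : (x, y) != (x', y') by apply/eqP => -[e _]; move: ex'; rewrite -e ex; lia.
  have ne2 : (v l, v l.+1) != (x, y) by apply/eqP => -[_ e]; move: ey; rewrite -e lvS; lia.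
  have ne3 : (v l, v l.+1) != (x', y') by apply/eqP => -[e _]; move: ex';
    rewrite -e lv; lia.
  rewrite (_ : 3 = #|[set (v l, v l.+1); (x, y); (x', y')]|).
    apply/subset_leq_card/fintype.subsetP => u; rewrite !inE => /orP[/orP[]|] /eqP->.
    - by rewrite /= a lv lvS; lia.
    - by rewrite /= xy ex ey; lia.
    - by rewrite /= xy' ex' ey'; lia.
  by rewrite -finset.setUA cardsU1 cards2 ne1 !inE negb_or ne2 ne3.
have c1 : 1 < #|cross1 lev l| by rewrite card_cross1 ?l0.
have pairP x y : (x, y) \in cross1 lev l ->
    adj x y /\ (lev x = p /\ lev y = p + 2 \/ x = v l /\ y = v l.+1).
  rewrite !inE /= => /andP[/andP[xy lt] h]; have le1 := lev_adj xy lt; have le2 := lev_le y.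
  split=> //; have [ex|ex] := eqVneq (lev x) p; first by left; split; lia.
  have ly : lev y = l.+1 by lia.
  have lx : lev x = l by move/eqP: ex; lia.
  by right; split; [rewrite -lx levK // lx | rewrite -ly levK // ly].
have /card_gt1P[[x y] [[x' y'] [xyc xyc' ne]]] := c1.
have [xy [[lx ly]|[<- <-]//]] := pairP _ _ xyc.
have [xy' [[lx' ly']|[<- <-]//]] := pairP _ _ xyc'.
case/eqP: ne; congr pair; first exact: (cross2_unique (leqnn _) xy lx ly xy' lx' ly').
by rewrite -[y]levK ?ly ?addn2 // -[y']levK ?ly' ?addn2.
Qed.

(** Levels identify the inner vertices. Exactly one leaf [l0] is adjacent to level 2, and all the
    other leaves hang from level 1. *)
Lemma cross_counts_isomorphic : isomorphic G (zigzag p b).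
Proof.
have [l0 [y0 [l0y0 ll0 ly0]]] := cross2_pair (ltn0Sn p).
have leafE x : (x \in leaves G) = (lev x == 0).
  by rewrite -[_ \in _]negbK -in_inner innerE lt0n negbK.
have l0l : l0 \in leaves G by rewrite leafE ll0.
have y0E : y0 = v 2 by rewrite -[y0]levK ly0.
(* The leaf [l0] is listed first because pendant 0 is the one attached to [inl 1]. *)
pose ls := l0 :: rem l0 (enum (leaves G)).
have pls : perm_eq (enum (leaves G)) ls by apply: perm_to_rem; rewrite mem_enum.
have uls : uniq ls by rewrite -(perm_uniq pls) enum_uniq.
have sls : size ls = b by rewrite -(perm_size pls) -cardE.
have lsl j : j < b -> nth l0 ls j \in leaves G.
  by move=> jb; rewrite -mem_enum (perm_mem pls) mem_nth ?sls.
pose f (x : zigzag p b) : G := match x with inl k => v k.+1 | inr j => nth l0 ls j end.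
have levf x : lev (f x) = zigzag_level x.
  case: x => [k|j] /=; first by apply: vK; have := ltn_ord k; lia.
  by apply/eqP; rewrite -leafE lsl.
apply: isomorphic_sym; apply: (@inj_isomorphic _ _ f).
- by rewrite cG card_sum !card_ord.
- move=> x1 x2 e; have := congr1 lev e; rewrite !levf.
  case: x1 x2 e => [k|j] [k'|j'] //= e.
    by move=> [ek]; congr inl; exact: val_inj.
  move=> _; congr inr; apply: val_inj => /=.
  by apply/eqP; rewrite -(nth_uniq l0 _ _ uls) ?sls // e.
have pend j k : j < b -> k < p + 2 -> adj (nth l0 ls j) (v k.+1) = (k == (j == 0)).
  move=> jb kp; have jl := lsl _ jb; have [y ey] := leaf_nbr jl.
  have jy : adj (nth l0 ls j) y by rewrite ey.
  have ly : 0 < lev y by rewrite -innerE; exact: leaf_nbr_inner jl jy.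
  have lj : lev (nth l0 ls j) = 0 by apply/eqP; rewrite -leafE.
  have := lev_adj jy; rewrite lj => /(_ ly); rewrite add0n => ly2.
  have vk : lev (v k.+1) = k.+1 by apply: vK; lia.
  have levj : lev y = (j == 0).+1.
    have [j0|j0] := eqVneq j 0.
      have := l0y0; rewrite -[l0]/(nth l0 ls 0) -j0 ey => /eqP <-.
      by rewrite ly0.
    have [e2|] := eqVneq (lev y) 2; last by move/eqP; lia.
    have e : nth l0 ls j = l0 by exact: (cross2_unique (ltn0Sn p) jy lj e2 l0y0 ll0 ly0).
    have := nth_uniq l0 (i := j) (j := 0) _ _ uls; rewrite sls => /(_ jb (ltnW b2)).
    by rewrite e eqxx (negPf j0).
  rewrite ey; apply/eqP/eqP => [e|->]; first by move: levj; rewrite -e vk; case.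
  by rewrite -levj levK.
have inner_adj k k' : k < k' < p + 2 ->
    adj (v k.+1) (v k'.+1) = (k' == k + 2) || (k + k' == 2 * p + 1).
  move=> kk'.
  have vk : lev (v k.+1) = k.+1 by apply: vK; lia.
  have vk' : lev (v k'.+1) = k'.+1 by apply: vK; lia.
  have [e1|ne1] := eqVneq k' k.+1.
    rewrite e1 adj_consecutive; last by lia.
    by apply/idP/idP; lia.
  have [e2|ne2] := eqVneq k' (k + 2).
    by rewrite e2 addn2 adj_skip //; lia.
  apply/idP/idP => [a|]; last by lia.
  by have := lev_adj a; rewrite vk vk'; lia.
case=> [k|j] [k'|j'] /=.
- have ltk := ltn_ord k; have ltk' := ltn_ord k'.
  case: (ltngtP k k') => kk'.
  + by rewrite inner_adj ?kk' //; apply/idP/idP; lia.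
  + by rewrite adjC inner_adj ?kk' //; apply/idP/idP; lia.
  + by rewrite kk' adj_irrefl; apply/esym/negbTE; lia.
- by rewrite adjC pend.
- exact: pend.
apply/negbTE/negP => /(leaf_nbr_inner trG G3 (lsl _ (ltn_ord j))).
by rewrite in_inner lsl.
Qed.

End ZigzagCase.

(** * Comparison with the comet *)

Section Comparison.
Local Open Scope ring_scope.
Variables (R : realType) (G : sgraph) (p b : nat).
Hypotheses (trG : is_tree G) (b2 : (2 <= b)%N).
Hypotheses (cG : #|G| = (p + 2 + b)%N) (inner_le : (#|inner G| <= p + 2)%N).

Let G3 : (2 < #|G|)%N. Proof. by rewrite cG; lia. Qed.

Lemma sorted_levels (f : {ffun G -> R}) : dirichlet f -> (forall x, 0 <= f x) ->
  exists (lev : G -> nat) (v : nat -> G) (a : nat -> R),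
    [/\ forall x, (lev x <= p.+2)%N,
        forall x, (0 < lev x)%N -> v (lev x) = x,
        forall j, (0 < j <= p.+2)%N -> lev (v j) = j
      & forall x, x \in inner G -> (0 < lev x)%N] /\
    [/\ a 0 = 0, forall i j, (i <= j <= p.+2)%N -> a i <= a j,
        f = a \o lev :> (G -> R)
      & sqnorm f = \sum_(l < p.+2) a l.+1 ^+ 2].
Proof.
move=> df f0.
(* Leaves, of value 0, fill the list up to length [p + 2] if there are fewer inner vertices. *)
pose s0 := enum (inner G) ++ take (p + 2 - #|inner G|) (enum (leaves G)).
pose s := sort (fun x y => f x <= f y) s0.
have us : uniq s.
  rewrite sort_uniq cat_uniq enum_uniq take_uniq ?enum_uniq // andbT.
  apply/hasPn => x /mem_take; rewrite !mem_enum in_inner => xl.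
  by rewrite xl.
have ss : size s = p.+2.
  rewrite size_sort size_cat size_take_min -!cardE.
  have := card_inner G; have := max_card (leaves G); rewrite cG.
  have := inner_le; lia.
have inner_s x : x \in inner G -> x \in s.
  by move=> xi; rewrite mem_sort mem_cat mem_enum xi.
have [r _] := inner_exists trG G3.
pose lev x := if x \in s then (index x s).+1 else 0%N.
pose v j := nth r s j.-1.
pose a j := if j is i.+1 then f (nth r s i) else 0.
have a_mono i j : (i <= j <= p.+2)%N -> a i <= a j.
  case: i j => [|i] [|j] //=; rewrite !ltnS => /andP[ij jp].
  have tr : transitive (fun x y : G => f x <= f y) by move=> y x z; exact: le_trans.
  have so : sorted (fun x y : G => f x <= f y) s by apply: sort_sorted => x y;
    exact: le_total.
  apply: (sorted_leq_nth tr _ r so) => //; rewrite inE ss //.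
  by lia.
have fE : f = a \o lev :> (G -> R).
  apply/funext => x; rewrite /= /lev; case: ifPn => xs /=; first by rewrite nth_index.
  by apply: df; apply: contraNT xs => xl; apply: inner_s; rewrite in_inner.
exists lev, v, a; split; split => //.
- by move=> x; rewrite /lev; case: ifP => // xs; rewrite -ss index_mem.
- by move=> x; rewrite /lev /v; case: ifP => // xs _; rewrite nth_index.
- by case=> [//|j] jp; rewrite /lev /v /= mem_nth ?ss // index_uniq ?ss.
- by move=> x /inner_s xs; rewrite /lev xs.
rewrite /sqnorm (bigID (mem s)) /= [X in _ + X]big1 ?addr0.
  by rewrite -big_uniq //= (big_nth r) ss big_mkord.
move=> x xs; rewrite df ?expr0n //.
by apply: contraNT xs => xl; apply: inner_s; rewrite in_inner.
Qed.

(** The sorted values of a first eigenfunction of [G], placed on the comet, give a test function [g]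
    of the same norm and no larger energy. *)
Theorem comet_comparison : lambda1 (zigzag p b) R <= lambda1 G R /\
  (lambda1 G R <= lambda1 (zigzag p b) R -> isomorphic G (Tpqb p 2 b)).
Proof.
have [x0 x0i] := inner_exists trG G3.
have [f [f0 df fge0 fE]] := lambda1_eigenfunction_ge0 R x0i.
have [lev [v [a [[lev_le levK vK inner_lev] [a0 a_mono flev sqf]]]]] := sorted_levels
  df fge0.
have leaf0 x : x \in leaves G -> a (lev x) = 0.
  by move=> /df; rewrite flev.
have leaves_ge : (b <= #|leaves G|)%N.
  have := card_inner G; have := max_card (leaves G); have := inner_le.
  rewrite cG; lia.
set l := lambda1 (zigzag p b) R.
pose g := zigzag_fun p b a.
have sqg : sqnorm g = sqnorm f by rewrite zigzag_sqnorm.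
have g0 : g != 0 by rewrite -sqnorm_gt0 sqg sqnorm_gt0.
have eg : energy2 g g = 2 * level_form p a b by exact: zigzag_energy.
have le_form : 2 * level_form p a b <= energy2 f f.
  rewrite flev; apply: (level_form_le_energy2 trG G3 lev_le levK vK inner_lev a0 a_mono
    leaf0).
  by move=> _.
have z0 : (0 < p + 2)%N by rewrite addn2.
have z0i : (inl (Ordinal z0) : zigzag p b) \in inner (zigzag p b).
  by rewrite in_inner zigzag_leaves.
have dg : dirichlet g by exact: zigzag_fun_dirichlet.
have lle : l <= lambda1 G R.
  by apply: (lambda1_le z0i g0 dg); rewrite eg (le_trans le_form) // fE sqg.
split=> // lge.
have lE : lambda1 G R = l by apply/le_anti; rewrite lle lge.
have eg_le : energy2 g g <= 2 * l * sqnorm g by rewrite eg (le_trans le_form) // fE sqg lE.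
have [_ minl] := lambda1_min R z0i.
(* If the first eigenvalues agree, then [g] is a minimizer on the comet. *)
have eigen k : (k < p.+2)%N -> zigzag_flux p b a k = l * a k.+1.
  rewrite -addn2 => kp.
  have := minimizer_eigenfunction dg eg_le minl (x := inl (Ordinal kp)).
  by rewrite zigzag_laplacian // ffunE; apply; rewrite in_inner zigzag_leaves.
have a1 : 0 < a 1.
  rewrite lt_def -{2}a0 a_mono // andbT; apply/eqP => a1.
  have := f0; rewrite -sqnorm_gt0 sqf big1 ?ltxx // => i _.
  by rewrite (zigzag_eigenfunction0 a0 a_mono eigen) ?expr0n.
(* Since [a 1 > 0], no leaf can occupy a positive level. *)
have innerE x : (x \in inner G) = (0 < lev x)%N.
  apply/idP/idP => [/inner_lev //|lx]; rewrite in_inner; apply: contraTN a1 => /leaf0 fx.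
  by rewrite -leNgt -fx a_mono // lx lev_le.
have cI : #|inner G| = (p + 2)%N.
  apply/eqP; rewrite eqn_leq inner_le /=.
  have <- : #|[set v i.+1 | i : 'I_(p + 2)]| = (p + 2)%N.
    rewrite card_imset ?card_ord // => i j e; apply: val_inj.
    have := congr1 lev e; rewrite !vK; first by case.
    - by rewrite /= -(addn2 p).
    - by rewrite /= -(addn2 p).
  apply/subset_leq_card/fintype.subsetP => _ /imsetP[i _ ->].
  by rewrite innerE vK //= -(addn2 p).
have cl : #|leaves G| = b.
  have := card_inner G; have := max_card (leaves G).
  rewrite cG cI; lia.
have [b_eq2|b_ne2] := eqVneq b 2.
  rewrite b_eq2; apply: two_leaves_isomorphic => //; first by rewrite cG b_eq2; lia.
  by rewrite cl.
have b3 : (2 < b)%N by rewrite ltn_neqAle eq_sym b_ne2.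
have gap_gt0 := zigzag_eigenfunction_gap a0 a_mono eigen b3 a1.
have [|lev_adj c1 c2] := energy2_le_level_form trG G3 lev_le levK vK inner_lev a0
  a_mono leaf0 (fun _ => leaves_ge) _ gap_gt0.
  by rewrite -flev fE -sqg lE -eg minl.
apply: isomorphic_trans (zigzag_isomorphic p b).
exact: (cross_counts_isomorphic trG G3 b2 lev_le levK vK innerE cG cl lev_adj c1 c2).
Qed.

End Comparison.

(** * The star and the characterization of the minimizers *)

(** A tree with matching number 1 has fewer than two inner vertices, so all its leaves share one
    neighbor. *)
Lemma matching_number1_star (G : sgraph) (n : nat) : 2 < n -> tree_class n 1 G ->
  isomorphic G (Kbip 1 (n - 1)).
Proof.
move=> n3 [trG cG mG]; have G3 : 2 < #|G| by rewrite cG.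
have [c ci] := inner_exists trG G3.
have lt2 := inner_lt_double_matching_number trG (ltnW G3).
have inner1 x : x \in inner G -> x = c.
  move=> xi; have /card_le1_eqP : #|inner G| <= 1 by move: lt2; rewrite mG.
  exact.
have cI : #|inner G| = 1.
  by apply/eqP/cards1P; exists c; apply/finset.setP => x; rewrite inE;
    apply/idP/eqP => [/inner1|->].
have cl : #|leaves G| = n - 1.
  have := card_inner G; have := max_card (leaves G); rewrite cI cG; lia.
have adj_leaf x y : x \in leaves G -> adj x y = (y == c).
  move=> xl; have [z ez] := leaf_nbr xl; rewrite ez.
  by rewrite -(inner1 z) //; apply: leaf_nbr_inner (xl) _ => //; rewrite ez.
have lc x : x \in leaves G -> x != c.
  by move=> xl; apply: contraTneq ci => <-; rewrite in_inner xl.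
pose s := enum (leaves G).
have ss : size s = n - 1 by rewrite -cardE.
have sl (j : 'I_(n - 1)) : nth c s j \in leaves G by rewrite -mem_enum mem_nth ?ss.
pose f (x : Kbip 1 (n - 1)) : G := if x is inr j then nth c s j else c.
apply: isomorphic_sym; apply: (@inj_isomorphic _ _ f).
- by rewrite card_sum !card_ord cG; lia.
- case=> [i|j] [i'|j'] //=.
  + by move=> _; rewrite (ord1 i) (ord1 i').
  + by move=> e; have := lc _ (sl j'); rewrite -e eqxx.
  + by move=> e; have := lc _ (sl j); rewrite e eqxx.
  by move/eqP; rewrite nth_uniq ?ss ?enum_uniq // => /eqP e; congr inr; apply: val_inj.
case=> [i|j] [i'|j'] /=.
- exact: adj_irrefl.
- by rewrite adjC adj_leaf ?eqxx.
- by rewrite adj_leaf ?eqxx.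
by rewrite adj_leaf // (negPf (lc _ (sl j'))).
Qed.

(** Serves both [n = 2 * m] and [n > 2 * m], which differ only in the bound on the number of inner
    vertices and hence in [p]. *)
Lemma faber_krahn_comet (R : realType) (n m p b : nat) (T : sgraph) :
  1 < b -> n = p + 2 + b -> m = (p + 4)./2 ->
  (forall G, tree_class n m G -> #|inner G| <= p + 2) ->
  faber_krahn R (tree_class n m) T <-> tree_class n m T /\ isomorphic T (Tpqb p 2 b).
Proof.
move=> b2 en em inner_le.
have cmp G : tree_class n m G -> (lambda1 (Tpqb p 2 b) R <= lambda1 G R)%R /\
    ((lambda1 G R <= lambda1 (Tpqb p 2 b) R)%R -> isomorphic G (Tpqb p 2 b)).
  move=> cG; have [trG nG _] := cG.
  rewrite -(isomorphic_lambda1 R (zigzag_isomorphic p b)).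
  by apply: comet_comparison => //; [rewrite nG | exact: inner_le].
have classC : tree_class n m (Tpqb p 2 b).
  split; [exact: comet_is_tree | by rewrite card_comet | by rewrite comet_matching_number].
split=> [[cT minT]|[cT isoT]].
  by split=> //; have [_] := cmp T cT; apply; exact: minT.
by split=> // T' /cmp[le _]; rewrite (isomorphic_lambda1 R isoT).
Qed.

Theorem theorem1p4 (R : realType) (n m : nat) (hn : 3 <= n) (hm : 1 <= m)
    (T : sgraph) :
  faber_krahn R (tree_class n m) T <->
  tree_class n m T /\
  ((m = 1 /\ isomorphic T (Kbip 1 (n - 1))) \/
   (2 <= m /\
    (2 * m + 1 <= n -> isomorphic T (Tpqb (2 * m - 3) 2 (n + 1 - 2 * m))) /\
    (n = 2 * m -> isomorphic T (Tpqb (2 * m - 4) 2 2)))).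
Proof.
have [m1|m1] := eqVneq m 1.
  (* For [m = 1] all members of the class are isomorphic, so each one is minimal. *)
  rewrite m1; split=> [[cT _]|[cT _]]; first by split=> //; left; split=> //;
    exact: matching_number1_star.
  split=> // T' cT'.
  by rewrite (isomorphic_lambda1 R (matching_number1_star hn cT))
    (isomorphic_lambda1 R (matching_number1_star hn cT')).
have m2 : 2 <= m by lia.
have inner_ltm G : tree_class n m G -> #|inner G| < 2 * m.
  by case=> trG nG <-; apply: inner_lt_double_matching_number => //; rewrite nG ltnW.
have nm G : tree_class n m G -> 2 * m <= n.
  by case=> _ <- <-; exact: double_matching_number_le.
have [n2m|n2m] := eqVneq n (2 * m).
  have FK : faber_krahn R (tree_class n m) T <->
      tree_class n m T /\ isomorphic T (Tpqb (2 * m - 4) 2 2).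
    apply: faber_krahn_comet => //; try lia.
    (* Here the two leaves give the bound [2 * m - 2], one better than the matching bound. *)
    move=> G [trG nG _]; rewrite card_inner // nG.
    by have := leaves_gt1 trG; rewrite nG => /(_ (ltnW hn)); lia.
  rewrite FK; split=> -[cT h]; split=> //; last by case: h => [[/eqP]|[_ [_]]];
    [rewrite (negPf m1) | apply].
  by right; split=> //; split=> // le; exfalso; lia.
split=> [FK|[cT]].
  have cT : tree_class n m T by case: FK.
  have lt := nm _ cT; split=> //; right; split=> //; split=> [le|/eqP];
    last by rewrite (negPf n2m).
  have [/(_ FK)[]//] : faber_krahn R (tree_class n m) T <->
      tree_class n m T /\ isomorphic T (Tpqb (2 * m - 3) 2 (n + 1 - 2 * m)).
  apply: faber_krahn_comet; try lia.
  by move=> G /inner_ltm; lia.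
have lt := nm _ cT; case=> [[/eqP]|[_ [h _]]]; first by rewrite (negPf m1).
apply/(@faber_krahn_comet R n m (2 * m - 3) (n + 1 - 2 * m)); try lia.
  by move=> G /inner_ltm; lia.
by split=> //; apply: h; lia.
Qed.
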